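(* Let $N=2n\geq4$ be even, $\omega=\exp(2\pi i/N)$, let $u\in\mathbb{C}$ with $u\neq0$, $u^N\neq1$, and let $A$, $J=A\Lambda A$, $e_a$, $\ell$, $x_{a,b}$ be as in the context. For $1\leq r\leq n$, $$J^r=\bigoplus_{\substack{a,b\in\mathbb{Z}/N\mathbb{Z}\\|\ell(a)-\ell(b)|\geq r}}\mathbb{C}\,x_{a,b}.$$ In particular, $$\dim A=N^2-N+2,\qquad \dim J^r=2+4(n-r)(n-r+1)\quad(1\leq r\leq n),$$ $$\dim A/J=N,\qquad \dim J^r/J^{r+1}=8(n-r)\quad(1\leq r<n),\qquad \dim J^n=2.$$ Moreover $J=\operatorname{Jac}(A)$ (the Jacobson radical), $J^n\neq0$ and $J^{n+1}=0$; thus the Loewy length of $A$, the least $r$ with $J^r=0$, is $n+1$. For each $a\in\mathbb{Z}/N\mathbb{Z}$ and $1\le r\le n$, the $r$th radical layer $e_aJ^r/e_aJ^{r+1}$ of the indecomposable right projective module $e_aA$ contains exactly once each simple module indexed by a residue $b$ with $|\ell(a)-\ell(b)|=r$, and no other simple.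
   Context: Index the standard basis of $\mathbb{C}^N$ by $j\in\mathbb{Z}/N\mathbb{Z}$ (writing $\epsilon_j$) and define $t\epsilon_j=\epsilon_{j-1}$, $d\epsilon_j=\omega^j\epsilon_j$. For $u\neq0$, $u^N\neq1$, the operator $ud-u^{-1}d^{-1}$ is invertible; put $s=(ud-u^{-1}d^{-1})^{-1}$ and, on $\mathbb{C}^{2N}=\mathbb{C}^N\oplus\mathbb{C}^N$, $$T=\begin{pmatrix}t&0\\0&t^{-1}\end{pmatrix},\qquad \Lambda=\begin{pmatrix}s&s\\-s&-s\end{pmatrix}.$$ $A=A_{N,u}$ is the unital subalgebra of $\operatorname{End}(\mathbb{C}^{2N})$ generated by $T$ and $\Lambda$, and $J=A\Lambda A$. For $a\in\mathbb{Z}/N\mathbb{Z}$, $e_a=\frac1N\sum_{k=0}^{N-1}\omega^{-ak}T^k$ (pairwise orthogonal primitive idempotents of $A$ summing to the identity), and the level of $a$ is $\ell(a)=\min\{\bar a,N-\bar a\}$ with $\bar a\in\{0,\ldots,N-1\}$ the standard representative. For $\ell(a)\neq\ell(b)$ the block $e_aAe_b$ is one-dimensional and $x_{a,b}$ denotes a nonzero element spanning it. The simple right module indexed by $b$ is the top of $e_bA$. *)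

(* Defs.v *)
From HB Require Import structures.
From mathcomp Require Import all_boot all_order all_algebra all_field.
From mathcomp Require Import complex.
From mathcomp Require Import boolp reals trigo.

Set Implicit Arguments.
Unset Strict Implicit.
Unset Printing Implicit Defensive.

Import Order.TTheory GRing.Theory Num.Theory.
Local Open Scope ring_scope.

Section RightModules.

Variables (K : fieldType) (aT : falgType K) (A : {aspace aT}).
Implicit Types (L M U V W P R : {vspace aT}).

(* All the right A-modules below are subquotients U / W of the ambient algebra,
   where W <= U are subspaces stable under right multiplication by A. *)

Definition right_submod M L : bool := (L <= M)%VS && (L * A <= L)%VS.

Definition maximal_submod M L : Prop :=
  [/\ right_submod M L, L != M &
      forall L', right_submod M L' -> (L <= L')%VS -> L' = L \/ L' = M].

Definition is_radical M R : Prop :=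
  forall x, x \in R <->
    x \in M /\ (forall L, maximal_submod M L -> x \in L).

(* The right submodules of A itself are its right ideals. *)
Definition is_jacobson_radical R : Prop := is_radical A R.

(* U / W and U' / W' are isomorphic right A-modules. An isomorphism is given by
   a linear lift f, of which only the values on U, modulo W', matter. *)
Definition quot_iso U W U' W' : Prop :=
  exists f : 'End(aT),
    [/\ (f @: U + W')%VS = U',
        forall x, x \in U -> (f x \in W') = (x \in W) &
        forall x a, x \in U -> a \in A -> f (x * a) - f x * a \in W'].

(* U / W is isomorphic to the top P / rad P of P. *)
Definition quot_iso_top U W P : Prop :=
  exists R, is_radical P R /\ quot_iso U W P R.

(* W = s_0 < s_1 < ... < s_k = U where s = [:: s_1; ...; s_k] and every
   s_i / s_(i-1) is a simple right A-module. *)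
Definition composition_series U W (s : seq {vspace aT}) : Prop :=
  last W s = U /\
  (forall i, (i < size s)%N -> maximal_submod (nth W s i) (nth W (W :: s) i)).

Definition top_multiplicity W (s : seq {vspace aT}) P : nat :=
  #|[set i : 'I_(size s) |
      `[< quot_iso_top (nth W s i) (nth W (W :: s) i) P >]]|.

(* The dimension of U / (U :&: V), i.e., of U / V when V <= U. *)
Definition dim_quot U V : nat := \dim (U :\: V).

(* Here 1%VS, the value of (V ^+ 0)%VS, stands for the zeroth power. *)
Definition is_loewy_length V (m : nat) : Prop :=
  (V ^+ m)%VS = 0%VS /\ (forall r, (V ^+ r)%VS = 0%VS -> (m <= r)%N).

End RightModules.

(* End(C^2N): matrices act on column vectors, so that the matrix product is the
   composition of operators.
   The index type 'Z_N is 'I_(Zp_trunc N).+2, with (Zp_trunc N).+2 = N as soon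
   as 1 < N. *)
Definition End2N (R : realType) (N : nat) : Type :=
  'M[R[i]]_((Zp_trunc N).+2 + (Zp_trunc N).+2).

HB.instance Definition _ (R : realType) (N : nat) :=
  Falgebra.copy (End2N R N) 'M[R[i]]_(((Zp_trunc N).+1 + (Zp_trunc N).+2).+1).

Section Algebra.

Variables (R : realType) (N : nat) (u : R[i]).

Local Notation d := (Zp_trunc N).+2.
Local Notation op := (End2N R N).

Definition omega : R[i] :=
  Complex (cos (2 * pi / N%:R)) (sin (2 * pi / N%:R)).

Definition t_mx : 'M[R[i]]_d := \matrix_(i < d, j < d) (i == j - 1 :> 'Z_N)%:R.

Definition d_mx : 'M[R[i]]_d := diag_mx (\row_(j < d) omega ^+ j).

Definition s_mx : 'M[R[i]]_d := invmx (u *: d_mx - u^-1 *: invmx d_mx).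

Definition T_op : op := block_mx t_mx 0 0 (invmx t_mx).

Definition Lambda_op : op := block_mx s_mx s_mx (- s_mx) (- s_mx).

Definition algA : {aspace op} := <<1 & [:: T_op; Lambda_op]>>%AS.

Definition idealJ : {vspace op} := (algA * <[Lambda_op]> * algA)%VS.

Definition idem (a : 'Z_N) : op :=
  N%:R^-1 *: \sum_(k < N) omega ^- (a * k) *: T_op ^+ k.

Definition projP (a : 'Z_N) : {vspace op} := (<[idem a]> * algA)%VS.

Definition block (a b : 'Z_N) : {vspace op} :=
  (<[idem a]> * algA * <[idem b]>)%VS.

Definition level (a : 'Z_N) : nat := minn a (N - a).

Definition level_dist (a b : 'Z_N) : nat :=
  `|(level a)%:Z - (level b)%:Z|%N.

(* The blocks with level a != level b are lines; x picks a generator of each. *)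
Definition spans_blocks (x : 'Z_N -> 'Z_N -> op) : Prop :=
  forall a b, level a != level b -> x a b != 0 /\ block a b = <[x a b]>%VS.

Definition eJ (a : 'Z_N) (r : nat) : {vspace op} :=
  (<[idem a]> * idealJ ^+ r)%VS.

End Algebra.

(* Main.v *)
(* In the Fourier basis f_a = sum_j omega^(a j) epsilon_j the operator T is
   diagonal, with omega^a-eigenspace V_a spanned by (f_a, 0) and (0, f_(-a)),
   while s acts as a circulant matrix whose entry c_m is u^m / (u^N - 1) for m
   odd and 0 for m even, by summing a geometric series. The component of Lambda
   from V_b to V_a thus vanishes when a - b is even; when a - b is odd it is a
   2x2 matrix of powers of u with rank one, whose image depends only on a and on
   which of the levels of a and b is larger, and whose kernel depends only on b
   and on the same comparison. Hence all composites of such maps along paths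
   of strictly monotone level from b to a are proportional to a single
   rank-one map x_(a,b). At a turning point of the levels the image of one map
   is the kernel of the next one, so the composite vanishes; at the other
   points it is nonzero as u^N <> 1. Therefore A is spanned by the e_a and the
   x_(a,b), and J^r by the x_(a,b) with level distance at least r. *)

Require Import Defs.
From mathcomp Require Import all_boot all_order all_algebra all_field.
From mathcomp Require Import complex zify ring lra.
From mathcomp Require Import boolp reals trigo.

Set Implicit Arguments.
Unset Strict Implicit.
Unset Printing Implicit Defensive.

Import Order.TTheory GRing.Theory Num.Theory.
Local Open Scope ring_scope.

(** * Algebras split by idempotents modulo a nilpotent ideal *)

Lemma memv_lineMP (K : fieldType) (aT : falgType K) (U : {vspace aT}) v w :
  reflect (exists2 u, u \in U & w = v * u) (w \in <[v]> * U)%VS.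
Proof.
apply: (iffP idP) => [|[u Uu ->]]; last exact: memv_mul (memv_line v) Uu.
suff /subvP/[apply]: (<[v]> * U <= amull v @: U)%VS.
  by case/memv_imgP => u Uu ->; exists u => //; rewrite lfunE.
apply/prodvP => _ u /vlineP[k ->] Uu; rewrite -scalerAl memvZ //.
by have := memv_img (amull v) Uu; rewrite lfunE.
Qed.

(** A line raises the dimension by at most one, so nothing fits strictly in between. This makes
    submodules of codimension one maximal. *)
Lemma subv_add_line (K : fieldType) (vT : vectType K) (L L' : {vspace vT}) x :
  (L <= L')%VS -> (L' <= L + <[x]>)%VS -> L' = L \/ L' = (L + <[x]>)%VS.
Proof.
move=> LL' L'x; have [xL'|xL'] := boolP (x \in L').
  by right; apply/eqP; rewrite eqEsubv L'x subv_add LL' -memvE.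
left; apply/eqP; rewrite eqEsubv LL' andbT; apply/subvP => y yL'.
have /memv_addP[l lL [_ /vlineP[k ->]] def_y] := subvP L'x _ yL'.
have [k0|k0] := eqVneq k 0; first by rewrite def_y k0 scale0r addr0.
have kx : k *: x = y - l by rewrite def_y addrAC subrr add0r.
case/negP: xL'; rewrite -[x](scalerK k0) memvZ // kx memvB //.
exact: subvP lL.
Qed.

(** Project onto the line of [x] along [W], then send [x] to [v]. This supplies the lifts required
    by [quot_iso]. *)
Lemma exists_lfun_line (K : fieldType) (vT wT : vectType K) (W : {vspace vT})
    (x : vT) (v : wT) :
  x \notin W -> exists2 f : 'Hom(vT, wT), f x = v & {in W, forall w, f w = 0}.
Proof.
move=> xW; have x0 : x != 0 by apply: contraNneq xW => ->; rewrite mem0v.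
have dxW : (<[x]> :&: W)%VS = 0%VS.
  apply/eqP; rewrite -subv0; apply/subvP => _ /memv_capP[/vlineP[k ->] kxW].
  rewrite memv0; apply: contraR xW; rewrite scaler_eq0 negb_or => /andP[k0 _].
  by rewrite -[x](scalerK k0) memvZ.
have [g] := linear_of_free [:: x] [:: v].
rewrite seq1_free x0 => /(_ isT erefl)[gx].
exists (linfun g \o daddv_pi <[x]> W)%VF => [|w wW].
  by rewrite comp_lfunE daddv_pi_id ?memv_line // lfunE.
have dWx : (W :&: <[x]>)%VS = 0%VS by rewrite capvC.
have := daddv_pi_add dWx (subvP (addvSl _ _) w wW).
rewrite (daddv_pi_id dWx wW) -[RHS]addr0 => /addrI h.
by rewrite comp_lfunE h linear0.
Qed.

Section BasicAlgebra.

Variables (K : fieldType) (aT : falgType K) (A : {aspace aT}).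
Variables (J : {vspace aT}) (m : nat) (I : finType) (e : I -> aT).
Hypotheses (sJA : (J <= A)%VS) (sAJ : (A * J <= J)%VS) (sJAJ : (J * A <= J)%VS).
Hypothesis Jnil : (J ^+ m)%VS = 0%VS.
Hypotheses (eA : forall i, e i \in A) (e1 : \sum_i e i = 1).
Hypothesis eM : forall i j, e i * e j = if i == j then e i else 0.
Hypothesis enJ : forall i, e i \notin J.
Hypothesis sAeJ : (A <= \sum_i <[e i]> + J)%VS.

(** Modulo [J] the algebra is spanned by the [e i], and orthogonality leaves only the term at [b].
    So [A] acts by scalars on the class of [e b] modulo [e b * J]. *)
Lemma idem_mulA b a : a \in A ->
  exists k j, j \in J /\ e b * a = k *: e b + e b * j.
Proof.
move=> /(subvP sAeJ)/memv_addP[x /memv_sumP[y ye ->] [j Jj ->]].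
have /vlineP[k yb] := ye b isT; exists k, j; split=> //.
rewrite mulrDr mulr_sumr (bigD1 b) //= yb -scalerAr eM eqxx big1 ?addr0 //.
move=> i ib; have /vlineP[l ->] := ye i isT.
by rewrite -scalerAr eM eq_sym (negPf ib) scaler0.
Qed.

Lemma sum_mul_idem x : \sum_i x * e i = x.
Proof. by rewrite -mulr_sumr e1 mulr1. Qed.

(** Nakayama's lemma for a nilpotent ideal: if [L + M * J] were [M], iteration would give
    [M <= L + M * J ^+ k] for all [k], and [k = m] would force [L = M]. *)
Lemma maximal_submod_mul_nil M L :
  (M * A <= M)%VS -> maximal_submod A M L -> (M * J <= L)%VS.
Proof.
move=> MA [/andP[LM LA] LneM maxL].
have sMJM : (M * J <= M)%VS := subv_trans (prodvSr M sJA) MA.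
have subL' : right_submod A M (L + M * J)%VS.
  rewrite /right_submod subv_add LM sMJM prodvDl addvS // -prodvA.
  by rewrite prodvSr.
have [<-|defM] := maxL _ subL' (addvSl _ _); first exact: addvSr.
suff /(_ m) : forall k, (M <= L + M * J ^+ k)%VS.
  rewrite Jnil prodv0 addv0 => ML; case/eqP: LneM.
  by apply/eqP; rewrite eqEsubv LM.
elim=> [|k /subv_trans]; first by rewrite expv0 prodv1 addvSr.
apply; rewrite subv_add addvSl /= -{1}defM prodvDl -prodvA -expvSl addvS //.
case: k => [|k]; first by rewrite expv0 prodv1.
apply: subv_trans LA; rewrite prodvSr // -(expv_id A k).
exact: expvS.
Qed.

Lemma add_line_maximal_submod L x :
  (L * A <= L)%VS -> x \notin L -> maximal_submod A (L + <[x]>)%VS L.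
Proof.
move=> LA xL; split=> [||L' /andP[L'L _] LL']; last exact: subv_add_line.
  by rewrite /right_submod addvSl.
apply: contraNneq xL => ->; apply: subvP (addvSr _ _) _ (memv_line x).
Qed.

Lemma idem_projective b : (<[e b]> * A = <[e b]> * J + <[e b]>)%VS.
Proof.
apply/eqP; rewrite eqEsubv subv_add prodvSr //=.
apply/andP; split; last first.
  by rewrite -memvE; apply/memv_lineMP; exists (e b); rewrite // eM eqxx.
apply/subvP => _ /memv_lineMP[a /(@idem_mulA b)[k [j [Jj ->]]] ->].
by rewrite addrC memv_add ?memvZ ?memv_line ?memv_mul ?memv_line.
Qed.

Lemma idem_notin_radical b : e b \notin (<[e b]> * J)%VS.
Proof.
apply: contra (enJ b); apply/subvP/(subv_trans _ sAJ).
by rewrite prodvSl // -memvE.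
Qed.

Lemma idem_radicalA b : (<[e b]> * J * A <= <[e b]> * J)%VS.
Proof. by rewrite -prodvA prodvSr. Qed.

(** Every maximal submodule contains [e b * J] by the Nakayama argument, and [e b * J] is itself
    maximal, having codimension one. *)
Lemma projective_is_radical b :
  is_radical A (<[e b]> * A)%VS (<[e b]> * J)%VS.
Proof.
move=> x; split=> [xJ|[xA]].
  split=> [|L]; first exact: subvP (prodvSr _ sJA) _ xJ.
  move/maximal_submod_mul_nil => maxL; apply: subvP (maxL _) _ _.
    by rewrite -prodvA prodv_id.
  apply: subvP xJ; rewrite prodvSl // -memvE.
  by apply/memv_lineMP; exists (e b); rewrite // eM eqxx.
apply; rewrite idem_projective; apply: add_line_maximal_submod.
  exact: idem_radicalA.
exact: idem_notin_radical.
Qed.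

Lemma is_radical_uniq M R R' :
  is_radical A M R -> is_radical A M R' -> R = R'.
Proof.
move=> radR radR'; apply/vspaceP => x; apply/idP/idP.
  by move=> /radR/radR'.
by move=> /radR'/radR.
Qed.

(* The maximal right ideals [x in A | e_b x in J] intersect in J. *)
Lemma nilpotent_is_jacobson_radical : is_jacobson_radical A J.
Proof.
move=> x; split=> [xJ|[xA xL]].
  split=> [|L]; first exact: subvP xJ.
  move/maximal_submod_mul_nil => maxL; apply: subvP (maxL _) _ _.
    by rewrite prodv_id.
  apply: subvP xJ; rewrite -{1}(prod1v J) prodvSl // -memvE -e1.
  exact: memv_suml.
rewrite -[x]mul1r -e1 mulr_suml memv_suml // => b _.
pose L := (A :&: amull (e b) @^-1: J)%VS.
have memL y : (y \in L) = (y \in A) && (e b * y \in J).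
  by rewrite memv_cap -memv_preim lfunE.
suff /xL : maximal_submod A A L by rewrite memL => /andP[].
have LA : (L * A <= L)%VS.
  apply/prodvP => y a; rewrite !memL => /andP[yA ybJ] aA.
  by rewrite memvM // mulrA; apply: subvP sJAJ _ (memv_mul _ _).
have defA : (L + <[e b]>)%VS = A.
  apply/eqP; rewrite eqEsubv subv_add capvSl -memvE eA /=.
  apply/subvP => y yA; have [k [j [Jj eby]]] := idem_mulA b yA.
  rewrite -[y](subrK (k *: e b)) memv_add ?memvZ ?memv_line //.
  rewrite memL memvB ?memvZ ?eA // mulrBr eby -scalerAr eM eqxx addrAC subrr.
  by rewrite add0r; apply: subvP sAJ _ (memv_mul _ _).
rewrite -{1}defA; apply: add_line_maximal_submod => //.
by rewrite memL eM eqxx negb_and enJ orbT.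
Qed.

(** Since [J] maps [U] into [W], the algebra multiplies the class of [x * e b] modulo [W] by scalars
    only. *)
Lemma add_line_submod U W x b :
  (U * A <= U)%VS -> (W * A <= W)%VS -> (U * J <= W)%VS -> x \in U ->
  ((W + <[x * e b]>) * A <= W + <[x * e b]>)%VS.
Proof.
move=> UA WA UJ xU; rewrite prodvDl addvC subv_add.
rewrite (subv_trans WA (addvSl _ _)) andbT.
apply/subvP => _ /memv_lineMP[a aA ->].
have [k [j [Jj]]] := idem_mulA b aA; rewrite -mulrA => ->.
rewrite mulrDr -scalerAr addrC memv_add ?memvZ ?memv_line //.
apply: subvP UJ _ (memv_mul xU _).
exact: subvP sAJ _ (memv_mul (eA b) Jj).
Qed.

Lemma maximal_submod_add_line U W y b :
    (U * A <= U)%VS -> maximal_submod A U W ->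
  y \in U -> y * e b \notin W -> (W + <[y * e b]>)%VS = U.
Proof.
move=> UA maxW yU xW; have UJ := maximal_submod_mul_nil UA maxW.
have [/andP[WU WA] _ maxWU] := maxW.
have xU : y * e b \in U by apply: subvP UA _ (memv_mul yU (eA b)).
have [||eqW|//] := maxWU (W + <[y * e b]>)%VS.
- rewrite /right_submod subv_add WU -memvE xU.
  exact: (@add_line_submod U W y b).
- exact: addvSl.
case/negP: xW; rewrite -eqW; exact: subvP (addvSr _ _) _ (memv_line _).
Qed.

(** A simple quotient [U / W] is a line on which [A] acts by scalars, with [J] acting as zero. The
    idempotent [e b] acts as the identity on the simple module indexed by [b] and as zero on the
    others, so its action detects the isomorphism class. *)
Lemma quot_iso_topP U W b : (U * A <= U)%VS -> maximal_submod A U W ->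
  quot_iso_top A U W (<[e b]> * A)%VS <-> ~~ (U * <[e b]> <= W)%VS.
Proof.
move=> UA maxW; have UJ := maximal_submod_mul_nil UA maxW.
have [/andP[WU WA] _ maxWU] := maxW.
have radE := projective_is_radical b; split=> [[R [radR]]|].
  rewrite (is_radical_uniq radR radE) => -[f [fU fW fM]].
  (* Lift [e b] to some [f y] modulo [e b * J] and multiply by [e b] on the right: if [y * e b] were
     in [W], then [e b] would lie in [e b * J]. *)
  have : e b \in (f @: U + <[e b]> * J)%VS.
    by rewrite fU idem_projective; apply: subvP (addvSr _ _) _ (memv_line _).
  case/memv_addP => _ /memv_imgP[y yU ->] [j Jj def_eb].
  have yeU : y * e b \in U by apply: subvP UA _ (memv_mul yU (eA b)).
  apply: contra (idem_notin_radical b) => UbW.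
  have : f (y * e b) \in (<[e b]> * J)%VS.
    by rewrite fW // (subvP UbW) ?memv_mul ?memv_line.
  move/(fun h => memvB h (fM _ _ yU (eA b))); rewrite subKr => fye.
  have jeb : j * e b \in (<[e b]> * J)%VS.
    by apply: subvP (idem_radicalA b) _ (memv_mul Jj (eA b)).
  by have := memvD fye jeb; rewrite -mulrDl -def_eb eM eqxx.
case/subvPn => _ /memv_cosetP[y yU ->] xW.
set x := y * e b in xW.
have xU : x \in U by apply: subvP UA _ (memv_mul yU (eA b)).
have xe : x * e b = x by rewrite /x -mulrA eM eqxx.
have defU : (W + <[x]>)%VS = U := maximal_submod_add_line UA maxW yU xW.
(* The isomorphism kills [W] and sends [x], which spans [U] modulo [W], to [e b]. *)
have [f fx fW] := exists_lfun_line (e b) xW.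
have fE w k : w \in W -> f (w + k *: x) = k *: e b.
  by move=> wW; rewrite linearD linearZ /= fx fW // add0r.
have defUx y' : y' \in U -> exists w k, w \in W /\ y' = w + k *: x.
  rewrite -defU => /memv_addP[w wW [_ /vlineP[k ->] ->]].
  by exists w, k.
exists (<[e b]> * J)%VS; split=> //; exists f; split.
- rewrite -defU limgD limg_line fx idem_projective addvC; congr (_ + _)%VS.
  apply/eqP; rewrite eqEsubv addvSr subv_add subvv !andbT.
  by apply/subvP => _ /memv_imgP[w wW ->]; rewrite fW // mem0v.
- move=> _ /defUx[w [k [wW ->]]]; rewrite fE //.
  have [->|k0] := eqVneq k 0; first by rewrite !scale0r mem0v addr0 wW.
  have kE (v : aT) (V : {vspace aT}) : v \notin V -> (k *: v \in V) = false.
    by apply: contraNF => kv; rewrite -[v](scalerK k0) memvZ.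
  rewrite kE ?idem_notin_radical //; apply/esym/negbTE.
  apply: contra (negbT (kE _ _ xW)) => wxW.
  by have := memvB wxW wW; rewrite addrAC subrr add0r.
move=> _ a /defUx[w [k [wW ->]]] aA; rewrite fE //.
have [l [j [Jj eba]]] := idem_mulA b aA.
have xa : x * a = l *: x + x * j.
  by rewrite -{1}xe -mulrA eba mulrDr -scalerAr mulrA xe.
have -> : (w + k *: x) * a = w * a + k *: (x * j) + (k * l) *: x.
  by rewrite mulrDl -scalerAl xa scalerDr scalerA addrA addrAC.
rewrite fE; last first.
  rewrite memvD ?memvZ //; first by apply: subvP WA _ (memv_mul wW aA).
  by apply: subvP UJ _ (memv_mul xU Jj).
rewrite -scalerAl eba scalerDr scalerA opprD addrA subrr add0r memvN memvZ //.
by rewrite memv_mul ?memv_line.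
Qed.

Lemma quot_iso_top_exists U W : (U * A <= U)%VS -> maximal_submod A U W ->
  exists b, quot_iso_top A U W (<[e b]> * A)%VS.
Proof.
move=> UA maxW; have [/andP[WU WA] neqWU _] := maxW.
have /forallPn[b Ub] : ~~ [forall b, U * <[e b]> <= W]%VS.
  apply: contra neqWU => /forallP allW; rewrite eqEsubv WU.
  apply/subvP => y yU; rewrite -(sum_mul_idem y) memv_suml // => b _.
  by apply: subvP (allW b) _ (memv_mul yU (memv_line _)).
by exists b; apply/quot_iso_topP.
Qed.

(** [U] is [W] plus the line of some [y * e c], and right multiplication by [e b] keeps this line if
    [b = c] and kills it otherwise. *)
Lemma dim_mul_idem_maximal U W b :
    (U * A <= U)%VS -> maximal_submod A U W ->
  \dim (U * <[e b]>) =
    (\dim (W * <[e b]>) + `[< quot_iso_top A U W (<[e b]> * A)%VS >])%N.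
Proof.
move=> UA maxW; have [c topc] := quot_iso_top_exists UA maxW.
have /subvPn[_ /memv_cosetP[y yU ->] xW] := (quot_iso_topP c UA maxW).1 topc.
have [/andP[WU WA] _ _] := maxW.
have defU := maximal_submod_add_line UA maxW yU xW.
have WeW b' : (W * <[e b']> <= W)%VS.
  by apply: subv_trans WA; rewrite prodvSr // -memvE.
have xeb : (<[y * e c]> * <[e b]>)%VS = <[if c == b then (y * e c)%R else 0%R]>%VS.
  by rewrite prodv_line -mulrA eM; case: eqP; rewrite ?mulr0.
have [cb|cb] := eqVneq c b; last first.
  have UW : (U * <[e b]>)%VS = (W * <[e b]>)%VS.
    by rewrite -defU prodvDl xeb (negPf cb) addv0.
  case: asboolP => [/(quot_iso_topP b UA maxW)|_]; last by rewrite UW addn0.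
  by rewrite UW WeW.
move: topc; rewrite cb => topb; rewrite (asboolT topb).
rewrite -defU prodvDl xeb cb eqxx dimv_disjoint_sum.
  rewrite dim_vline; case: eqP => // x0.
  by case/negP: xW; rewrite cb x0 mem0v.
apply/eqP; rewrite -subv0; apply/subvP => z /memv_capP[zW /vlineP[k def_z]].
have {}zW := subvP (WeW b) _ zW.
have [k0|k0] := eqVneq k 0; first by rewrite def_z k0 scale0r mem0v.
by case/negP: xW; rewrite cb -[y * e b](scalerK k0) -def_z memvZ.
Qed.

(** As the [e b] sum to one, some [y * e b] lies outside [W] unless [W] is [U]. Adjoining its line
    gives a simple factor and reduces the gap in dimension. *)
Lemma composition_series_exists U W :
    (U * A <= U)%VS -> (W * A <= W)%VS -> (W <= U)%VS -> (U * J <= W)%VS ->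
  exists s, composition_series A U W s.
Proof.
move=> UA; have [k] := ubnP (\dim U - \dim W).
elim: k W => // k IHk W ltk WA WU UJ.
have [<-|neqWU] := eqVneq W U; first by exists [::].
have /forallPn[b /subvPn[_ /memv_cosetP[y yU ->] xW]] :
    ~~ [forall b, U * <[e b]> <= W]%VS.
  apply: contra neqWU => /forallP allW; rewrite eqEsubv WU.
  apply/subvP => y yU; rewrite -(sum_mul_idem y) memv_suml // => b _.
  by apply: subvP (allW b) _ (memv_mul yU (memv_line _)).
pose S := (W + <[y * e b]>)%VS.
have maxS : maximal_submod A S W by apply: add_line_maximal_submod.
have SA : (S * A <= S)%VS by apply: (@add_line_submod U).
have SU : (S <= U)%VS.
  by rewrite subv_add WU -memvE (subvP UA) ?memv_mul.
have WS : (W <= S)%VS by apply: addvSl.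
have ltWS : (\dim W < \dim S)%N.
  rewrite ltn_neqAle dimvS // andbT; apply: contraNneq xW => eqd.
  have /eqP-> : W == S by rewrite eqEdim WS eqd leqnn.
  exact: subvP (addvSr _ _) _ (memv_line _).
have [||||s [lastS maxs]] := IHk S => //.
- by rewrite -ltnS (leq_trans _ ltk) // ltnS ltn_sub2l // (leq_trans ltWS) ?dimvS.
- exact: subv_trans WS.
exists (S :: s); split=> // -[|i] //= lti.
(* The series above [S] uses the default [S], the extended one uses [W]; all indices are in range,
   so the values agree. *)
rewrite (set_nth_default S) // [nth W _ _](set_nth_default S); last exact: ltnW.
exact: maxs.
Qed.

(** * Multiplicities in a composition series *)

Section CompositionSeries.

Variables (U W : {vspace aT}) (s : seq {vspace aT}).
Hypotheses (UA : (U * A <= U)%VS) (ser : composition_series A U W s).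

Lemma composition_series_submod i :
  (i < size s)%N -> (nth W s i * A <= nth W s i)%VS.
Proof.
have [lastU maxs] := ser; move=> lti.
have [lti1|gei1] := ltnP i.+1 (size s).
  by have [/andP[]] := maxs _ lti1.
have -> : i = (size s).-1 by lia.
by rewrite nth_last lastU.
Qed.

(** The steps of [dim_mul_idem_maximal] telescope along the series. Hence the multiplicity does not
    depend on the chosen series. *)
Lemma composition_multiplicity b :
  \dim (U * <[e b]>) =
    (\dim (W * <[e b]>) + top_multiplicity A W s (<[e b]> * A))%N.
Proof.
have [lastU maxs] := ser.
have <- : nth W (W :: s) (size s) = U := etrans (nth_last W (W :: s)) lastU.
rewrite /top_multiplicity cardsE -sum1_card big_mkcond /=.
pose q i := `[< quot_iso_top A (nth W s i) (nth W (W :: s) i) (<[e b]> * A)%VS >].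
suff /(_ (size s) (leqnn _))-> : forall k, (k <= size s)%N ->
    \dim (nth W (W :: s) k * <[e b]>) = (\dim (W * <[e b]>) + \sum_(i < k) q i)%N.
  by congr (_ + _)%N; apply: eq_bigr => i _; rewrite unfold_in /q; case: ifP.
elim=> [|k IHk] ltk; first by rewrite big_ord0 addn0.
rewrite big_ord_recr /= addnA -IHk 1?ltnW //.
exact: dim_mul_idem_maximal (composition_series_submod ltk) (maxs _ ltk).
Qed.

Lemma composition_factor_top i : (i < size s)%N ->
  exists2 b, (0 < top_multiplicity A W s (<[e b]> * A))%N &
    quot_iso_top A (nth W s i) (nth W (W :: s) i) (<[e b]> * A)%VS.
Proof.
move=> lti; have [_ maxs] := ser.
have [b topb] := quot_iso_top_exists (composition_series_submod lti) (maxs i lti).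
exists b => //; apply/card_gt0P; exists (Ordinal lti).
by rewrite inE; apply/asboolP.
Qed.

End CompositionSeries.

End BasicAlgebra.

(** * Algebras spanned by monotone paths between levels *)

Lemma prodv_sum_sub (K : fieldType) (aT : falgType K) (I I' : finType)
    (P : pred I) (P' : pred I') (U : I -> {vspace aT}) (U' : I' -> {vspace aT})
    (W : {vspace aT}) :
  (forall i j, P i -> P' j -> (U i * U' j <= W)%VS) ->
  ((\sum_(i | P i) U i) * (\sum_(j | P' j) U' j) <= W)%VS.
Proof.
move=> UW; apply/prodvP => _ _ /memv_sumP[u uU ->] /memv_sumP[v vU ->].
rewrite mulr_suml memv_suml // => i Pi; rewrite mulr_sumr memv_suml // => j Pj.
exact: subvP (UW i j Pi Pj) _ (memv_mul (uU i Pi) (vU j Pj)).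
Qed.

(** * Peirce components for orthogonal idempotents *)

Section Peirce.

Variables (K : fieldType) (aT : falgType K) (I : finType) (e : I -> aT).
Hypothesis eM : forall i j, e i * e j = if i == j then e i else 0.

(** Multiplying a vanishing sum by [e p.1] on the left and by [e p.2] on the right isolates its term
    at [p]. *)
Lemma peirce_directv (P : pred (I * I)) (z : I * I -> aT) :
    (forall p, P p -> e p.1 * z p * e p.2 = z p) ->
  directv (\sum_(p | P p) <[z p]>)%VS.
Proof.
move=> ez; apply/directv_sum_independent => us us_z sum0 p Pp.
have eu q : P q -> e q.1 * us q * e q.2 = us q.
  by move=> Pq; have /vlineP[k ->] := us_z q Pq; rewrite -scalerAr -scalerAl ez.
have := congr1 (fun y => e p.1 * y * e p.2) sum0.
rewrite mulr0 mul0r mulr_sumr mulr_suml (bigD1 p) //= eu // big1 ?addr0 //.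
move=> q /andP[Pq qp]; rewrite -(eu q Pq) !mulrA eM -!mulrA eM.
case: eqP => [p1|]; last by rewrite !mul0r.
case: eqP => [p2|]; last by rewrite !mulr0.
by case/eqP: qp; case: (p) (q) p1 p2 => [? ?] [? ?] /= -> ->.
Qed.

Lemma peirce_dim (P : pred (I * I)) (z : I * I -> aT) :
    (forall p, P p -> e p.1 * z p * e p.2 = z p) ->
  \dim (\sum_(p | P p) <[z p]>)%VS = #|[pred p | P p && (z p != 0)]|.
Proof.
move/peirce_directv/directvP => /= ->; rewrite -sum1_card /= big_mkcondr /=.
by apply: eq_bigr => p _; rewrite dim_vline; case: (_ != 0).
Qed.

Lemma peirce_component (z : I -> I -> aT) a b :
    (forall a b, e a * z a b * e b = z a b) ->
  e a * (\sum_a' \sum_b' z a' b') * e b = z a b.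
Proof.
move=> ez; rewrite mulr_sumr mulr_suml (bigD1 a) //= [X in _ + X]big1 ?addr0 => [|a' a'a].
  rewrite mulr_sumr mulr_suml (bigD1 b) //= big1 ?addr0 => [|b' b'b] //.
  by rewrite -ez -!mulrA eM (negPf b'b) !mulr0.
rewrite mulr_sumr mulr_suml big1 // => b' _.
by rewrite -ez !mulrA eM eq_sym (negPf a'a) !mul0r.
Qed.

End Peirce.

(** * Powers of the ideal and corners from the multiplication rules *)

Section LevelAlgebra.

Variables (K : fieldType) (aT : falgType K) (I : finType) (lev : I -> nat).
Variables (e : I -> aT) (x : I -> I -> aT) (T L : aT).

(** Subtraction is truncated, so at most one summand is nonzero and the sum is the absolute
    difference. *)
Definition ldist a b := ((lev a - lev b) + (lev b - lev a))%N.

Definition monotone a b c :=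
  (lev a < lev b < lev c)%N || (lev c < lev b < lev a)%N.

Hypotheses (e1 : \sum_i e i = 1) (e_neq0 : forall i, e i != 0).
Hypothesis eM : forall i j, e i * e j = if i == j then e i else 0.
Hypothesis exe : forall a b, e a * x a b * e b = x a b.
Hypothesis x_eq0 : forall a b, (x a b == 0) = (lev a == lev b).
Hypothesis xM : forall a b c, monotone a b c ->
  exists2 k : K, k != 0 & x a b * x b c = k *: x a c.
Hypothesis xM0 : forall a b c, ~~ monotone a b c -> x a b * x b c = 0.
Hypothesis lev_between : forall a b k,
  (lev a < k < lev b)%N -> exists c, lev c = k.

Local Notation A := (<<1 & [:: T; L]>>%AS).
Local Notation J := (A * <[L]> * A)%VS.

Hypotheses (Te : T \in (\sum_a <[e a]>)%VS) (eA : forall a, e a \in A).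
Hypothesis Lx : L \in (\sum_(p : I * I) <[x p.1 p.2]>)%VS.
Hypothesis eLe : forall a b, ldist a b = 1%N ->
  exists2 k : K, k != 0 & e a * L * e b = k *: x a b.

Definition xspan r : {vspace aT} :=
  (\sum_(p : I * I | (r <= ldist p.1 p.2)%N) <[x p.1 p.2]>)%VS.

Definition espan : {vspace aT} := (\sum_a <[e a]>)%VS.

Lemma ex a b : e a * x a b = x a b.
Proof. by rewrite -exe !mulrA eM eqxx. Qed.

Lemma xe a b : x a b * e b = x a b.
Proof. by rewrite -exe -mulrA eM eqxx. Qed.

Lemma mul_xx a b b' c :
  x a b * x b' c = if b == b' then x a b * x b' c else 0.
Proof.
case: eqP => // /eqP bb'.
by rewrite -(xe a b) -(ex b' c) mulrA -(mulrA _ (e b)) eM (negPf bb') mulr0 mul0r.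
Qed.

Lemma mul_ex a b c : e a * x b c = if a == b then x b c else 0.
Proof.
rewrite -{1}(ex b c) mulrA eM; case: eqP => [->|]; first exact: ex.
by rewrite mul0r.
Qed.

Lemma mul_xe a b c : x a b * e c = if b == c then x a b else 0.
Proof.
rewrite -{1}(xe a b) -mulrA eM; case: eqP => [_|]; first exact: xe.
by rewrite mulr0.
Qed.

Lemma mem_xspan r a b : (r <= ldist a b)%N -> x a b \in xspan r.
Proof.
move=> rab; rewrite /xspan memvE.
exact: (@sumv_sup _ _ _ (a, b) (fun p => (r <= ldist p.1 p.2)%N)
  _ (fun p => <[x p.1 p.2]>%VS)).
Qed.

Lemma ldist_eq0 a b : (ldist a b == 0%N) = (lev a == lev b).
Proof. by rewrite /ldist addn_eq0 !subn_eq0 -eqn_leq. Qed.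

Lemma monotone_ldist a b c : monotone a b c ->
  ldist a c = (ldist a b + ldist b c)%N.
Proof. rewrite /monotone /ldist; clear; move: (lev a) (lev b) (lev c); lia. Qed.

(** Distances add along monotone triples, and all other products vanish. *)
Lemma xspan_mul r s : (xspan r * xspan s <= xspan (r + s))%VS.
Proof.
apply: prodv_sum_sub => -[a b] [b' c] /= rab sbc.
rewrite prodv_line -memvE mul_xx.
case: eqP => [bb'|_]; last exact: mem0v; subst b'.
have [abc|abc] := boolP (monotone a b c); last by rewrite xM0 // mem0v.
have [k _ ->] := xM abc; rewrite memvZ // mem_xspan //.
by rewrite (monotone_ldist abc) leq_add.
Qed.

Lemma xspan_anti r s : (r <= s)%N -> (xspan s <= xspan r)%VS.
Proof.
move=> rs; apply/subv_sumP => -[a b] /= sab.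
by rewrite -memvE mem_xspan // (leq_trans rs).
Qed.

(** Pairs of equal level contribute nothing, as [x] vanishes there. So [Lx], which ranges over all
    pairs, places [L] in [xspan 1]. *)
Lemma xspan0 : xspan 0 = xspan 1.
Proof.
apply/eqP; rewrite eqEsubv (xspan_anti (leq0n 1)) andbT; apply/subv_sumP => -[a b] _ /=.
rewrite -memvE; have [/eqP ab|ab] := posnP (ldist a b); last exact: mem_xspan.
by move: ab; rewrite ldist_eq0 -x_eq0 => /eqP->; rewrite mem0v.
Qed.

Lemma espan_xspan r : (espan * xspan r <= xspan r)%VS.
Proof.
apply: prodv_sum_sub => a [b c] /= _ rbc; rewrite prodv_line -memvE mul_ex.
by case: ifP => _; rewrite ?mem0v ?mem_xspan.
Qed.

Lemma xspan_espan r : (xspan r * espan <= xspan r)%VS.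
Proof.
apply: prodv_sum_sub => [[a b] c] /= rab _; rewrite prodv_line -memvE mul_xe.
by case: ifP => _; rewrite ?mem0v ?mem_xspan.
Qed.

Lemma espanM : (espan * espan <= espan)%VS.
Proof.
apply: prodv_sum_sub => a b _ _; rewrite prodv_line -memvE eM.
case: ifP => _; rewrite ?mem0v //.
by rewrite memvE; apply: (sumv_sup a).
Qed.

(** The index [c] is taken one level away from [b], on the side of [a]: this splits a last step of
    length one off the path. *)
Lemma ldist_between r a b : (0 < r)%N -> (r < ldist a b)%N ->
  exists c, [/\ monotone a c b, (r <= ldist a c)%N & ldist c b = 1%N].
Proof.
move=> r0 rab; have [ab|ba] := ltnP (lev a) (lev b).
  have [|c lc] := @lev_between a b (lev b).-1.
    by move: rab ab r0; rewrite /ldist; clear; move: (lev a) (lev b); lia.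
  exists c; move: rab ab r0; rewrite /monotone /ldist lc; clear.
  by move: (lev a) (lev b) => i j *; split; lia.
have [|c lc] := @lev_between b a (lev b).+1.
  by move: rab ba r0; rewrite /ldist; clear; move: (lev a) (lev b); lia.
exists c; move: rab ba r0; rewrite /monotone /ldist lc; clear.
by move: (lev a) (lev b) => i j *; split; lia.
Qed.

Lemma xspanSr r : (0 < r)%N -> (xspan r * xspan 1)%VS = xspan r.+1.
Proof.
move=> r0; apply/eqP; rewrite eqEsubv -[r.+1]addn1 xspan_mul addn1 /=.
apply/subv_sumP => -[a b] /= rab; rewrite -memvE.
have [c [acb rac cb]] := ldist_between r0 rab.
have [k k0 xac] := xM acb; rewrite -[x a b](scalerK k0) -xac memvZ //.
by rewrite memv_mul ?mem_xspan ?cb.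
Qed.

(** By induction on the distance, splitting off last steps makes each [x a b] a nonzero multiple of
    a product of elements at distance one. *)
Lemma xspan1_min (Z : {vspace aT}) : (Z * Z <= Z)%VS ->
  (forall a b, ldist a b = 1%N -> x a b \in Z) -> (xspan 1 <= Z)%VS.
Proof.
move=> ZZ xZ; apply/subv_sumP => -[a b] /=; rewrite -memvE.
have [k] := ubnP (ldist a b); elim: k a b => // k IHk a b ltk.
rewrite leq_eqVlt eq_sym => /predU1P[/xZ //|ab].
have [c [acb ac cb]] := ldist_between (ltn0Sn 0) ab.
have [l l0 xac] := xM acb; rewrite -[x a b](scalerK l0) -xac memvZ //.
apply: subvP ZZ _ (memv_mul _ (xZ _ _ cb)); apply: IHk => //.
by rewrite -ltnS (leq_trans _ ltk) // (monotone_ldist acb) cb addn1.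
Qed.

Lemma mem_x_gen (Z : {vspace aT}) a b : (A * Z <= Z)%VS -> (Z * A <= Z)%VS ->
  L \in Z -> ldist a b = 1%N -> x a b \in Z.
Proof.
move=> AZ ZA LZ /eLe[k k0 eLk]; rewrite -[x a b](scalerK k0) -eLk memvZ //.
apply: subvP ZA _ (memv_mul _ (eA b)).
exact: subvP AZ _ (memv_mul (eA a) LZ).
Qed.

Lemma L_in_xspan1 : L \in xspan 1.
Proof. by rewrite -xspan0. Qed.

Lemma espan_sub : (espan <= A)%VS.
Proof. by apply/subv_sumP => a _; rewrite -memvE. Qed.

Lemma L_in_A : L \in A.
Proof. by apply: seqv_sub_adjoin; rewrite !inE eqxx orbT. Qed.

(** The right side contains 1 and the generators and is closed under products. Conversely the
    corners of [L] at distance one yield the [x a b] there, and these generate [xspan 1]. *)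
Lemma level_algE : A = (espan + xspan 1)%VS :> {vspace aT}.
Proof.
have xx : (xspan 1 * xspan 1 <= xspan 1)%VS.
  by apply: subv_trans (xspan_mul 1 1) (xspan_anti _).
apply/eqP; rewrite eqEsubv subv_add espan_sub /=; apply/andP; split; last first.
  apply: xspan1_min => [|a b]; first by rewrite prodv_id.
  by apply: mem_x_gen; rewrite ?prodv_id // L_in_A.
apply: agenv_sub_modl.
  rewrite -memvE -e1; apply: memv_suml => a _; apply: (subvP (addvSl _ _)).
  by rewrite memvE; apply: (sumv_sup a).
apply: (@subv_trans _ _ ((espan + xspan 1) * (espan + xspan 1))%VS).
  apply: prodvSl; rewrite subv_add -memvE; apply/andP; split.
    rewrite -e1; apply: memv_suml => a _; apply: (subvP (addvSl _ _)).
    by rewrite memvE; apply: (sumv_sup a).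
  apply/span_subvP => y; rewrite !inE => /orP[] /eqP->.
    exact: subvP (addvSl _ _) _ Te.
  exact: subvP (addvSr _ _) _ L_in_xspan1.
rewrite prodvDl !prodvDr !subv_add (subv_trans espanM) ?addvSl //.
by rewrite !(subv_trans _ (addvSr _ _)) ?espan_xspan ?xspan_espan.
Qed.

Lemma alg_xspan r : (A * xspan r <= xspan r)%VS.
Proof.
rewrite level_algE prodvDl subv_add espan_xspan.
by rewrite (subv_trans (xspan_mul _ _)) // xspan_anti // leq_addl.
Qed.

Lemma xspan_alg r : (xspan r * A <= xspan r)%VS.
Proof.
rewrite level_algE prodvDr subv_add xspan_espan.
by rewrite (subv_trans (xspan_mul _ _)) // xspan_anti // leq_addr.
Qed.

Lemma level_idealE : J = xspan 1.
Proof.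
apply/eqP; rewrite eqEsubv; apply/andP; split.
  apply: subv_trans (xspan_alg 1); apply: prodvSl.
  apply: subv_trans (alg_xspan 1); apply: prodvSr.
  by rewrite -memvE L_in_xspan1.
have AJ : (A * J <= J)%VS by rewrite !prodvA prodv_id.
have JA : (J * A <= J)%VS by rewrite -!prodvA prodv_id.
have LJ : L \in J.
  have one : 1 \in A by rewrite memvE sub1_agenv.
  by have := memv_mul (memv_mul one (memv_line L)) one; rewrite mul1r mulr1.
apply: xspan1_min => [|a b]; last exact: mem_x_gen.
apply: subv_trans JA; apply: prodvSr.
by apply: prodv_sub => //; apply: prodv_sub; rewrite // -memvE L_in_A.
Qed.

Lemma level_ideal_expE r : (0 < r)%N -> (J ^+ r)%VS = xspan r.
Proof.
rewrite level_idealE; case: r => // r _; elim: r => [|r IHr] //.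
by rewrite expvSr IHr xspanSr.
Qed.

Lemma level_ideal_nil r : (0 < r)%N -> (forall a, lev a < r)%N ->
  (J ^+ r)%VS = 0%VS.
Proof.
move=> r0 levr; rewrite level_ideal_expE // /xspan big1 // => -[a b] /=.
move: (levr a) (levr b) r0; rewrite /ldist.
by clear; move: (lev a) (lev b) => i j; lia.
Qed.

Lemma corner_xspan r a b : (<[e a]> * xspan r * <[e b]>)%VS =
  (if (r <= ldist a b)%N then <[x a b]> else 0)%VS.
Proof.
apply/eqP; rewrite eqEsubv; apply/andP; split; last first.
  case: ifP => [rab|_]; last exact: sub0v.
  by rewrite -memvE -exe !memv_mul ?memv_line ?mem_xspan.
apply/subvP => _ /memv_cosetP[_ /memv_lineMP[y /memv_sumP[u ux ->] ->] ->].
rewrite mulr_sumr mulr_suml memv_suml // => -[a' b'] /= rab.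
have /vlineP[k ->] := ux (a', b') rab.
rewrite -scalerAr -scalerAl mul_ex.
have [aa'|_] := eqVneq a a'; last by rewrite mul0r scaler0 mem0v.
rewrite mul_xe; have [bb'|_] := eqVneq b' b; last by rewrite scaler0 mem0v.
by rewrite aa' -bb' rab memvZ ?memv_line.
Qed.

Lemma corner_espan a b :
  (<[e a]> * espan * <[e b]>)%VS = (if (a == b)%B then <[e a]> else 0)%VS.
Proof.
apply/eqP; rewrite eqEsubv; apply/andP; split; last first.
  case: eqP => [<-|_]; last exact: sub0v.
  have eaa : e a * e a = e a by rewrite eM eqxx.
  rewrite -memvE -{1}eaa -{1}eaa !memv_mul ?memv_line //.
  by rewrite memvE; apply: (sumv_sup a).
apply/subvP => _ /memv_cosetP[_ /memv_lineMP[_ /memv_sumP[u ue ->] ->] ->].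
rewrite mulr_sumr mulr_suml memv_suml // => c _; have /vlineP[k ->] := ue c isT.
rewrite -scalerAr -scalerAl eM; case: eqP => [_|_]; last by rewrite mul0r scaler0 mem0v.
by rewrite eM; case: eqP => [->|_]; rewrite ?memvZ ?memv_line // scaler0 mem0v.
Qed.

Lemma corner_alg a b : lev a != lev b ->
  (<[e a]> * A * <[e b]>)%VS = <[x a b]>%VS.
Proof.
move=> ab; rewrite level_algE prodvDr prodvDl corner_xspan corner_espan lt0n ldist_eq0 ab.
by have [ab'|_] := eqVneq a b; [rewrite ab' eqxx in ab | rewrite add0v].
Qed.

(** The corner [e a * J * e a] sits at distance zero and vanishes, whereas [e a] is its own
    corner. *)
Lemma e_notin_ideal a : e a \notin J.
Proof.
rewrite level_idealE; apply: contra (e_neq0 a) => ea.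
have := memv_mul (memv_mul (memv_line (e a)) ea) (memv_line (e a)).
by rewrite corner_xspan !eM eqxx eM eqxx lt0n ldist_eq0 eqxx memv0.
Qed.

Lemma dim_xspan r : (0 < r)%N ->
  \dim (xspan r) = #|[pred p : I * I | (r <= ldist p.1 p.2)%N]|.
Proof.
move=> r0; rewrite (peirce_dim eM) => [|[a b] _]; last exact: exe.
apply: eq_card => -[a b]; rewrite !inE /=; apply: andb_idr => rab.
by rewrite x_eq0 -ldist_eq0 -lt0n (leq_trans r0).
Qed.

Lemma dim_level_alg : \dim A = (#|I| + \dim (xspan 1))%N.
Proof.
rewrite level_algE dimv_disjoint_sum; last first.
  (* All corners of a common element vanish: the diagonal ones because it is in [xspan 1], the
     others because it is in [espan]. *)
  apply/eqP; rewrite -subv0; apply/subvP => y /memv_capP[ye yx].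
  rewrite memv0 -[y]mul1r -[_ * y]mulr1 -e1 mulr_suml mulr_sumr big1 // => b _.
  rewrite mulr_suml big1 // => a _.
  have := memv_mul (memv_mul (memv_line (e a)) ye) (memv_line (e b)).
  have := memv_mul (memv_mul (memv_line (e a)) yx) (memv_line (e b)).
  rewrite corner_xspan corner_espan lt0n ldist_eq0.
  have [->|_] := eqVneq a b; first by rewrite eqxx memv0 => /eqP.
  by move=> _; rewrite memv0 => /eqP.
congr (_ + _)%N.
have /directvP /= -> : directv espan.
  apply/directv_sum_independent => us us_e sum0 a _.
  have := congr1 ( *%R (e a)) sum0; rewrite mulr0 mulr_sumr (bigD1 a) //= big1.
    by have /vlineP[k ->] := us_e a isT; rewrite addr0 -scalerAr eM eqxx.
  move=> b ba; have /vlineP[k ->] := us_e b isT.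
  by rewrite -scalerAr eM eq_sym (negPf ba) scaler0.
by rewrite -sum1_card; apply: eq_bigr => a _; rewrite dim_vline e_neq0.
Qed.

End LevelAlgebra.

(** * The operators T and Lambda in the Fourier basis *)

Section RootOfUnity.

Variables (R : realType) (M : nat).
Local Notation N := M.+2.
Local Notation C := R[i].
Local Notation w := (omega R N).

Lemma omegaX k : w ^+ k =
  Complex (cos (2 * pi / N%:R * k%:R)) (sin (2 * pi / N%:R * k%:R)).
Proof.
elim: k => [|k IHk]; first by rewrite expr0 mulr0 cos0 sin0.
rewrite exprS IHk /omega; set t := 2 * pi / N%:R.
rewrite -[k.+1%:R]natr1 (mulrDr t) mulr1 addrC cosD sinD.
by rewrite [LHS]/GRing.mul /= [cos _ * sin _ + _]addrC.
Qed.

Lemma omega_prim : N.-primitive_root w.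
Proof.
apply/andP; split=> //; apply/forallP => i; rewrite unity_rootE omegaX.
have N0 : (N%:R : R) != 0 by rewrite pnatr_eq0.
have [iN|iN] := eqVneq i.+1 N.
  by rewrite iN mulfVK // mulr_natl cos2pi sin2pi !eqxx.
have lti : (i.+1 < N)%N by rewrite ltn_neqAle iN ltn_ord.
rewrite eqbF_neg; apply/negP => /eqP[cos1 _].
(* Here [y] is half the angle of the power. A cosine equal to 1 would force [sin y = 0], but [y]
   lies strictly between 0 and [pi]. *)
pose y : R := pi / N%:R * i.+1%:R.
have defy : 2 * pi / N%:R * i.+1%:R = y *+ 2 by rewrite /y; ring.
have : 0 < sin y.
  apply: sin_gt0_pi; rewrite /y !mulr_gt0 ?pi_gt0 ?invr_gt0 ?ltr0n //=.
  by rewrite -mulrA gtr_pMr ?pi_gt0 // mulrC ltr_pdivrMr ?ltr0n // mul1r ltr_nat.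
have := cos2Dsin2 y; move: cos1; rewrite defy mulr2n cosD; nra.
Qed.

Definition chi (a : 'Z_N) : C := w ^+ a.

Lemma chiD a b : chi (a + b) = chi a * chi b.
Proof. by rewrite /chi -exprD -[RHS](prim_expr_mod omega_prim). Qed.

Lemma chi0 : chi 0 = 1. Proof. exact: expr0. Qed.

Lemma chi_neq0 a : chi a != 0.
Proof.
apply/eqP => a0; have := oner_neq0 C.
by rewrite -chi0 -(subrr a) chiD a0 mul0r eqxx.
Qed.

Lemma chiN a : chi (- a) = (chi a)^-1.
Proof. by apply: (mulIf (chi_neq0 a)); rewrite -chiD addNr chi0 mulVf ?chi_neq0. Qed.

Lemma chiM a b : chi (a * b) = w ^+ (a * b)%N.
Proof. by rewrite -[RHS](prim_expr_mod omega_prim). Qed.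

Lemma chi_sum a : \sum_j chi (a * j) = if a == 0 then N%:R else 0.
Proof.
case: eqP => [->|/eqP a0].
  by under eq_bigr => j _ do rewrite mul0r chi0; rewrite sumr_const card_ord.
have chi1 : chi a - 1 != 0.
  rewrite subr_eq0 /chi -[1](expr0 w) (eq_prim_root_expr omega_prim).
  by rewrite !modn_small.
apply: (mulfI chi1); rewrite mulr0.
under eq_bigr => j _ do rewrite chiM exprM.
by rewrite -subrX1 -/(chi a) /chi -exprM mulnC exprM (prim_expr_order omega_prim) expr1n subrr.
Qed.

Lemma chi_sum_delta a b :
  \sum_(j : 'Z_N) (chi (a * j) / chi (b * j)) = if a == b then N%:R else 0.
Proof.
rewrite -subr_eq0 -chi_sum; apply: eq_bigr => j _.
by rewrite mulrBl chiD chiN.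
Qed.

(** These are the matrix units of the Fourier basis: [Fmx a b] sends f_b to f_a and kills the other
    basis vectors. *)
Definition Fmx (a b : 'Z_N) : 'M[C]_N :=
  \matrix_(i < N, j < N) (N%:R^-1 * (chi (a * i) / chi (b * j))).

Let N_neq0 : (N%:R : C) != 0. Proof. by rewrite pnatr_eq0. Qed.

Lemma FmxM a b b' c : Fmx a b *m Fmx b' c = if b == b' then Fmx a c else 0.
Proof.
apply/matrixP => i j; rewrite mxE.
have -> : \sum_k Fmx a b i k * Fmx b' c k j =
    N%:R^-1 * N%:R^-1 * (chi (a * i) / chi (c * j)) *
      \sum_k (chi (b' * k) / chi (b * k)).
  by rewrite mulr_sumr; apply: eq_bigr => k _; rewrite !mxE; ring.
rewrite chi_sum_delta eq_sym; case: eqP => _; rewrite !mxE ?mulr0 //.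
by move: N_neq0; move: (N%:R : C) => v v0; field; rewrite chi_neq0 v0.
Qed.

Lemma Fmx_sum : \sum_a Fmx a a = 1%:M.
Proof.
apply/matrixP => i j; rewrite summxE !mxE.
have -> : \sum_a Fmx a a i j = N%:R^-1 * \sum_a (chi (i * a) / chi (j * a)).
  rewrite mulr_sumr; apply: eq_bigr => k _.
  by rewrite mxE ![k * _]mulrC.
rewrite chi_sum_delta; case: eqP => _; rewrite ?mulr0 //.
by rewrite mulVf.
Qed.

Lemma invmx_uniq n (B D : 'M[C]_n) : B *m D = 1%:M -> invmx B = D.
Proof.
by move=> BD; have [uB _] := mulmx1_unit BD; rewrite -[D](mulKmx uB) BD mulmx1.
Qed.

Lemma t_mxE : t_mx R N = \sum_a chi a *: Fmx a a.
Proof.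
rewrite -[LHS]mulmx1 -Fmx_sum mulmx_sumr; apply: eq_bigr => a _.
apply/matrixP => i j; rewrite !mxE (bigD1 (i + 1 : 'Z_N)) //= !mxE addrK eqxx.
rewrite big1 => [|k ki]; last first.
  rewrite !mxE; case: eqP => [ik|]; last by rewrite mul0r.
  by case/eqP: ki; rewrite ik subrK.
by rewrite mulrDr mulr1 chiD addr0 mulr1n; ring.
Qed.

Lemma inv_t_mxE : invmx (t_mx R N) = \sum_a chi a *: Fmx (- a) (- a).
Proof.
apply: invmx_uniq; rewrite t_mxE -Fmx_sum mulmx_suml; apply: eq_bigr => a _.
rewrite mulmx_sumr (bigD1 (- a)) //= big1 => [|b ba].
  rewrite addr0 opprK -scalemxAl -scalemxAr FmxM eqxx scalerA chiN.
  by rewrite mulfV ?chi_neq0 // scale1r.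
rewrite -scalemxAl -scalemxAr FmxM; case: eqP => [ab|]; last by rewrite !scaler0.
by case/eqP: ba; rewrite ab opprK.
Qed.

Variables (n : nat) (u : C).
Hypotheses (N2n : N = (2 * n)%N) (u0 : u != 0) (uN : u ^+ N != 1).

(** For z = [u * chi i], the inverse of z - 1/z is the sum of the odd powers of z below N divided by
    z^N - 1 = u^N - 1. These are its Fourier coefficients as a function of [i]. *)
Definition coef (m : 'Z_N) : C := if odd m then u ^+ m / (u ^+ N - 1) else 0.

(** Since (z - 1/z) z^i = z^(i+1) - z^(i-1), the sum over odd i telescopes. *)
Lemma sum_odd_geom (z : C) k : z != 0 ->
  (z - z^-1) * \sum_(i < k.*2 | odd i) z ^+ i = z ^+ k.*2 - 1.
Proof.
move=> z0; elim: k => [|k IHk].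
  by rewrite big_pred0 ?mulr0 ?expr0 ?subrr // => -[].
rewrite doubleS big_mkcond !big_ord_recr -big_mkcond /= odd_double /= addr0.
by rewrite mulrDr IHk !exprS; field.
Qed.

Lemma uchi_neq0 i : u * chi i != 0. Proof. by rewrite mulf_neq0 ?chi_neq0. Qed.

Lemma sum_coef i :
  (u * chi i - (u * chi i)^-1) * \sum_m coef m * chi (m * i) = 1.
Proof.
have uN1 : u ^+ N - 1 != 0 by rewrite subr_eq0.
have -> : \sum_m coef m * chi (m * i) =
    (\sum_(m < N | odd m) (u * chi i) ^+ m) / (u ^+ N - 1).
  rewrite mulr_suml [RHS]big_mkcond; apply: eq_bigr => m _.
  rewrite /coef; case: ifP => _; last by rewrite mul0r.
  by rewrite chiM mulnC exprM exprMn; ring.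
have Nd : N = n.*2 by rewrite N2n mul2n.
rewrite mulrA; move: (sum_odd_geom n (uchi_neq0 i)); rewrite -Nd => ->.
by rewrite exprMn -exprM mulnC exprM (prim_expr_order omega_prim) expr1n mulr1 mulfV.
Qed.

(** Multiplication by the character of index m sends f_b to f_(b+m), so the entry of [s_mx] from f_b
    to f_a is the coefficient at m = a - b. *)
Lemma s_mxE : s_mx N u = \sum_a \sum_b coef (a - b) *: Fmx a b.
Proof.
have d_inv : invmx (d_mx R N) = diag_mx (\row_j (chi j)^-1).
  apply: invmx_uniq; rewrite /d_mx mulmx_diag -diag_const_mx; congr diag_mx.
  by apply/rowP => j; rewrite !mxE mulfV ?chi_neq0.
have -> : s_mx N u = diag_mx (\row_i \sum_m coef m * chi (m * i)).
  apply: invmx_uniq; rewrite d_inv -diag_const_mx /d_mx -!linearZ -linearB /=.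
  rewrite mulmx_diag; congr diag_mx; apply/rowP => j; rewrite !mxE.
  by rewrite -[RHS](sum_coef j) invfM.
rewrite -[LHS]mulmx1 -Fmx_sum mulmx_sumr exchange_big; apply: eq_bigr => b _ /=.
apply/matrixP => i j; rewrite mul_diag_mx summxE !mxE mulr_suml.
rewrite (reindex_inj (addIr (- b))) /=; apply: eq_bigr => a _.
rewrite !mxE mulrBl chiD chiN; move: N_neq0; move: (N%:R : C) => v v0.
by field; rewrite !chi_neq0 v0.
Qed.

Local Notation op := (End2N R N).

(* The operator with matrix [[p, q], [r, s]] from the eigenspace of T for
   omega^b to the one for omega^a, in the bases (f_a, 0), (0, f_(-a)) where
   f_a = sum_j omega^(a j) epsilon_j. *)
Definition Gop (a b : 'Z_N) (p q r s : C) : op :=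
  block_mx (p *: Fmx a b) (q *: Fmx a (- b)) (r *: Fmx (- a) b) (s *: Fmx (- a) (- b)).

Lemma End2N_mulE (B D : op) : B * D = B *m D :> 'M[C]_(N + N).
Proof. by []. Qed.

Lemma GopM a b b' c p q r s p' q' r' s' :
  Gop a b p q r s * Gop b' c p' q' r' s' =
  if b == b' then Gop a c (p * p' + q * r') (p * q' + q * s')
                      (r * p' + s * r') (r * q' + s * s') else 0.
Proof.
rewrite End2N_mulE mulmx_block -!scalemxAl -!scalemxAr !FmxM eqr_opp.
case: eqP => _; last by rewrite !scaler0 !addr0 -[RHS]block_mx0.
by rewrite !scalerA -!scalerDl.
Qed.

Lemma Gop_congr a b p q r s p' q' r' s' :
  p = p' -> q = q' -> r = r' -> s = s' -> Gop a b p q r s = Gop a b p' q' r' s'.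
Proof. by move=> -> -> -> ->. Qed.

Lemma GopZ k a b p q r s :
  k *: Gop a b p q r s = Gop a b (k * p) (k * q) (k * r) (k * s).
Proof. by rewrite [LHS]scale_block_mx !scalerA. Qed.

Lemma Gop0 a b : Gop a b 0 0 0 0 = 0.
Proof. by rewrite /Gop !scale0r block_mx0. Qed.

Lemma Gop_neq0 a b p q r s : p != 0 -> Gop a b p q r s != 0.
Proof.
move=> p0; apply: contraNneq p0 => /(congr1 (fun B : 'M_(N + N) => ulsubmx B)).
rewrite block_mxKul => /matrixP/(_ 0 0); rewrite !mxE => /eqP.
by rewrite !mulf_eq0 !invr_eq0 !(negPf (chi_neq0 _)) (negPf N_neq0) !orbF.
Qed.

Lemma sum_block_mx (I : finType) m1 m2 n1 n2 (A1 : I -> 'M[C]_(m1, n1))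
    (A2 : I -> 'M_(m1, n2)) (A3 : I -> 'M_(m2, n1)) (A4 : I -> 'M_(m2, n2)) :
  \sum_i block_mx (A1 i) (A2 i) (A3 i) (A4 i) =
  block_mx (\sum_i A1 i) (\sum_i A2 i) (\sum_i A3 i) (\sum_i A4 i).
Proof.
apply/matrixP => i j; rewrite summxE.
rewrite !mxE; case Ei: (split i) => [i'|i']; rewrite !mxE;
  case Ej: (split j) => [j'|j']; rewrite summxE; apply: eq_bigr => k _;
  by rewrite !mxE Ei !mxE Ej.
Qed.

Definition idemG a : op := Gop a a 1 0 0 1.

Lemma idemG_sum : \sum_a idemG a = 1.
Proof.
rewrite [LHS]sum_block_mx.
under eq_bigr => a _ do rewrite scale1r; rewrite Fmx_sum.
rewrite big1 => [|a _]; last exact: scale0r.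
rewrite big1 => [|a _]; last exact: scale0r.
rewrite (reindex_inj oppr_inj) /=.
under eq_bigr => a _ do rewrite scale1r opprK; rewrite Fmx_sum.
exact: esym (scalar_mx_block N N (1 : C)).
Qed.

Lemma T_opE : T_op R N = \sum_a chi a *: idemG a.
Proof.
under eq_bigr => a _ do rewrite GopZ mulr1 mulr0.
rewrite [RHS]sum_block_mx /T_op inv_t_mxE t_mxE; congr block_mx.
- by rewrite big1 // => a _; rewrite scale0r.
- by rewrite big1 // => a _; rewrite scale0r.
Qed.

Lemma Lambda_opE : Lambda_op N u = \sum_a \sum_b
  Gop a b (coef (a - b)) (coef (a + b)) (- coef (- a - b)) (- coef (b - a)).
Proof.
rewrite pair_big [RHS]sum_block_mx /Lambda_op s_mxE.
(* The second copy of C^N carries the vector f_(-a) for the index [a]. So each block is reindexed by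
   the identity or negation in its rows ([f]) and columns ([g]). *)
have E (f g : 'Z_N -> 'Z_N) : involutive f -> involutive g ->
    \sum_a \sum_b coef (a - b) *: Fmx a b =
    \sum_p coef (f p.1 - g p.2) *: Fmx (f p.1) (g p.2).
  move=> ff gg; rewrite -(pair_big xpredT xpredT
    (fun a b => coef (f a - g b) *: Fmx (f a) (g b))) /=.
  rewrite (reindex_inj (inv_inj ff)); apply: eq_bigr => a _.
  by rewrite (reindex_inj (inv_inj gg)).
congr block_mx.
- exact: (E id id).
- by rewrite (E id -%R) //; [apply: eq_bigr => p _; rewrite opprK | exact: opprK].
- rewrite (E -%R id) //; last exact: opprK.
  by rewrite -sumrN; apply: eq_bigr => p _; rewrite scaleNr.
- rewrite (E -%R -%R); [|exact: opprK|exact: opprK].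
  by rewrite -sumrN; apply: eq_bigr => p _; rewrite scaleNr opprK addrC.
Qed.

Lemma idemG_M a b : idemG a * idemG b = if a == b then idemG a else 0.
Proof.
rewrite /idemG GopM; case: (a =P b) => [<-|//].
by apply: Gop_congr; ring.
Qed.

Lemma idemG_neq0 a : idemG a != 0.
Proof. by apply: Gop_neq0; apply: oner_neq0. Qed.

Lemma T_opX k : T_op R N ^+ k = \sum_a chi a ^+ k *: idemG a.
Proof.
elim: k => [|k IHk].
  by rewrite expr0 -idemG_sum; apply: eq_bigr => a _; rewrite scale1r.
rewrite exprS IHk T_opE mulr_suml; apply: eq_bigr => a _.
rewrite mulr_sumr (bigD1 a) //= big1 => [|b ba].
  by rewrite addr0 -scalerAl -scalerAr idemG_M eqxx scalerA -exprS.
by rewrite -scalerAl -scalerAr idemG_M eq_sym (negPf ba) !scaler0.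
Qed.

Lemma idemE a : idem R a = idemG a.
Proof.
rewrite /idem.
have -> : \sum_(k < N) w ^- (a * k) *: T_op R N ^+ k =
    \sum_b (if b == a then N%:R else 0) *: idemG b.
  under eq_bigr => k _ do rewrite T_opX scaler_sumr.
  rewrite exchange_big; apply: eq_bigr => b _ /=.
  rewrite -chi_sum_delta scaler_suml; apply: eq_bigr => k _.
  by rewrite scalerA !chiM mulrC /chi -exprM.
rewrite (bigD1 a) // big1 => [|b /= ba]; last first.
  by rewrite (negPf ba) scale0r.
by rewrite /= addr0 eqxx scalerA mulVf // scale1r.
Qed.

Lemma idemG_in_alg a : idemG a \in algA N u.
Proof.
rewrite -idemE memvZ // memv_suml // => k _; rewrite memvZ //.
have TA : T_op R N \in algA N u by apply: seqv_sub_adjoin; rewrite inE eqxx.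
elim: (k : nat) => [|j IHj]; last by rewrite exprS memvM.
by rewrite expr0 memvE sub1_agenv.
Qed.

End RootOfUnity.

(* The matrix of e_a Lambda e_b has entries u^(a-b), u^(a+b), u^(-a-b), u^(b-a),
   up to a common factor and signs, with all the exponents reduced modulo 2n.
   These shifts are the differences between the reduced exponents. *)
Definition shift (n a : nat) (d : bool) : int :=
  (2 * a)%:Z - (2 * n)%:Z +
  (if d then if (a < n)%N then (2 * n)%:Z else - (2 * n)%:Z else 0).

Section ShiftArithmetic.

Variables n a b : nat.
Hypotheses (lta : (a < 2 * n)%N) (ltb : (b < 2 * n)%N).
Let la := minn a (2 * n - a).
Let lb := minn b (2 * n - b).
Let add := (if a + b < 2 * n then a + b else a + b - 2 * n)%N.
Let sub := (if b <= a then a - b else 2 * n + a - b)%N.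
Hypothesis lab : la != lb.

(** Which half contains [b] and which level is larger determine the difference of the two reductions
    modulo [2 * n], even where they do not determine each reduction separately. *)
Lemma shift_add : add%:Z = sub%:Z + shift n b (lb < la)%N.
Proof.
move: lta ltb lab; rewrite /shift /add /sub /la /lb /minn; clear.
by do !case: ifP; lia.
Qed.

Lemma shift_opp_add : (2 * n - add)%N%:Z = sub%:Z - shift n a (la < lb)%N.
Proof.
move: lta ltb lab; rewrite /shift /add /sub /la /lb /minn; clear.
by do !case: ifP; lia.
Qed.

Lemma shift_opp_sub :
  (2 * n - sub)%N%:Z = sub%:Z - (shift n a (la < lb)%N - shift n b (lb < la)%N).
Proof.
move: lta ltb lab; rewrite /shift /add /sub /la /lb /minn; clear.
by do !case: ifP; lia.
Qed.

End ShiftArithmetic.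

(** * The path basis and its products *)

Section PathBasis.

Variables (R : realType) (M n : nat).
Local Notation N := M.+2.
Local Notation C := R[i].
Variable u : C.
Hypotheses (N2n : N = (2 * n)%N) (u0 : u != 0) (uN : u ^+ N != 1).

Lemma ltn_Z2n (a : 'Z_N) : (a < 2 * n)%N.
Proof. by rewrite -N2n; apply: ltn_ord. Qed.

Lemma val_addZ (a b : 'Z_N) :
  (a + b : 'Z_N) = (if a + b < 2 * n then a + b else a + b - 2 * n)%N :> nat.
Proof.
rewrite -N2n /=; case: ltnP => [lt|le]; first by rewrite modn_small.
rewrite -{1}(subnK le) modnDr modn_small // ltn_subLR //.
by rewrite -addSn leq_add // 1?ltnW ?ltn_ord.
Qed.

Lemma val_oppZ (a : 'Z_N) : a != 0 -> (- a : 'Z_N) = (2 * n - a)%N :> nat.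
Proof.
move=> a0; rewrite -N2n /= modn_small // ltn_subrL lt0n.
by rewrite andbT; apply: contra a0 => /eqP a0; apply/eqP/val_inj.
Qed.

Lemma val_subZ (a b : 'Z_N) :
  (a - b : 'Z_N) = (if b <= a then a - b else 2 * n + a - b)%N :> nat.
Proof.
have [->|b0] := eqVneq b 0; first by rewrite subr0 subn0.
have lta := ltn_Z2n a; have ltb := ltn_Z2n b.
have b0' : (0 < b)%N by rewrite lt0n; apply: contra b0 => /eqP h; apply/eqP/val_inj.
rewrite val_addZ val_oppZ //; move: lta ltb b0'.
clear; move: (a : nat) (b : nat) => i j; do !case: ifP; lia.
Qed.

Lemma odd_addZ (a b : 'Z_N) : odd (a + b)%R = odd a (+) odd b.
Proof.
rewrite val_addZ; case: ltnP => h; first by rewrite oddD.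
by rewrite oddB // oddD oddM addbF.
Qed.

Lemma odd_oppZ (a : 'Z_N) : odd (- a)%R = odd a.
Proof. by have := odd_addZ a (- a); rewrite subrr /=; do 2!case: odd. Qed.

Lemma levelE (a : 'Z_N) : level a = minn a (2 * n - a).
Proof. by rewrite -N2n. Qed.

Lemma odd_level (a : 'Z_N) : odd (level a) = odd a.
Proof.
by have lta := ltn_Z2n a; rewrite levelE /minn; case: ifP => // _; rewrite oddB 1?ltnW // oddM.
Qed.

(** The matrix is the column (1, -l) times the row (1, k), hence of rank one. Once it is known which
    level is larger, the column depends only on [a] and the row only on [b]. *)
Definition xG (a b : 'Z_N) : End2N R N :=
  if level a == level b then 0 else
  let k := u ^ shift n b (level b < level a)%N in
  let l := u ^ (- shift n a (level a < level b)%N) in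
  Gop a b 1 k (- l) (- (l * k)).

Lemma coefE (m : 'Z_N) : odd m -> coef u m = u ^ (m : nat)%:Z / (u ^+ N - 1).
Proof. by rewrite /coef => ->. Qed.

Lemma coef_neq0 (m : 'Z_N) : odd m -> coef u m != 0.
Proof.
by move=> om; rewrite coefE // mulf_neq0 ?expfz_neq0 // invr_neq0 // subr_eq0.
Qed.

(** For [a - b] even all coefficients vanish. For [a - b] odd the levels have different parities,
    and the shift identities extract [coef u (a - b)] from all four entries. *)
Lemma Gop_coefE (a b : 'Z_N) :
  Gop a b (coef u (a - b)) (coef u (a + b)) (- coef u (- a - b)) (- coef u (b - a))
    = coef u (a - b) *: xG a b.
Proof.
have [oab|eab] := boolP (odd a (+) odd b); last first.
  have c0 (m : 'Z_N) : odd m = odd a (+) odd b -> coef u m = 0.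
    by rewrite /coef => ->; rewrite (negPf eab).
  by rewrite !c0 ?odd_addZ ?odd_oppZ // 1?addbC // scale0r oppr0 Gop0.
have lab : level a != level b.
  by apply: contraTneq oab => lab; rewrite -!odd_level lab addbb.
rewrite /xG (negPf lab) /= GopZ.
have oP : odd (a + b)%R by rewrite odd_addZ.
have oM : odd (a - b)%R by rewrite odd_addZ odd_oppZ.
(* Odd residues are nonzero, so their opposites have representative [2 * n - m] and not 0. *)
have oddn0 (m : 'Z_N) : odd m -> m != 0 by apply: contraTneq => ->.
have lta := ltn_Z2n a; have ltb := ltn_Z2n b.
rewrite !levelE in lab *.
have -> : - a - b = - (a + b) by rewrite opprD.
have -> : b - a = - (a - b) by rewrite opprB.
have oP' : odd (- (a + b))%R by rewrite odd_oppZ.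
have oM' : odd (- (a - b))%R by rewrite odd_oppZ.
rewrite (coefE oP) (coefE oM) (coefE oP') (coefE oM') (val_oppZ (oddn0 _ oP)).
rewrite (val_oppZ (oddn0 _ oM)) (val_addZ a b) (val_subZ a b).
rewrite (shift_opp_sub lta ltb lab) (shift_opp_add lta ltb lab).
rewrite (shift_add lta ltb lab) opprB.
by apply: Gop_congr; rewrite ?expfzDr //; ring.
Qed.

Lemma idemG_Gop (a b c : 'Z_N) (p q r s : C) :
  idemG R a * Gop b c p q r s = if a == b then Gop a c p q r s else 0.
Proof. by rewrite GopM; case: (a == b); [apply: Gop_congr; ring | ]. Qed.

Lemma Gop_idemG (a b c : 'Z_N) (p q r s : C) :
  Gop a b p q r s * idemG R c = if b == c then Gop a b p q r s else 0.
Proof. by rewrite GopM; case: (b =P c) => [<-|_]; [apply: Gop_congr; ring | ]. Qed.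

Lemma idem_xG_idem (a b : 'Z_N) : idemG R a * xG a b * idemG R b = xG a b.
Proof.
rewrite /xG; case: ifP => _; first by rewrite mulr0 mul0r.
by rewrite idemG_Gop eqxx Gop_idemG eqxx.
Qed.

Lemma xG_eq0 (a b : 'Z_N) : (xG a b == 0) = (level a == level b).
Proof.
rewrite /xG; case: ifP => _; first by rewrite eqxx.
by apply/negbTE/Gop_neq0/oner_neq0.
Qed.

Lemma Gop_rank1M (a b c : 'Z_N) (k l k' l' : C) :
  Gop a b 1 k (- l) (- (l * k)) * Gop b c 1 k' (- l') (- (l' * k')) =
  (1 - k * l') *: Gop a c 1 k' (- l) (- (l * k')).
Proof. by rewrite GopM eqxx GopZ; apply: Gop_congr; ring. Qed.

(** The scalar pairs the row of the first factor with the column of the second. Both belong to [b],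
    so it depends only on [b] and the two comparisons of its level. *)
Lemma xG_mul (a b c : 'Z_N) (p := (level b < level a)%N) (q := (level b < level c)%N)
    (k := u ^ (- shift n a (level a < level b)%N))
    (l := u ^ shift n c (level c < level b)%N) :
  level a != level b -> level b != level c ->
  xG a b * xG b c = (1 - u ^ (shift n b p - shift n b q)) *: Gop a c 1 l (- k) (- (k * l)).
Proof.
move=> ab bc; rewrite /xG (negPf ab) (negPf bc) Gop_rank1M.
by rewrite (expfzDr (shift n b p) (- shift n b q) u0).
Qed.

(** At a turning point the two comparisons at [b] agree, so the exponent is 0 and the scalar
    vanishes. Equal neighbouring levels give a zero factor. *)
Lemma xG_mul_eq0 (a b c : 'Z_N) : ~~ monotone (@level N) a b c -> xG a b * xG b c = 0.
Proof.
have [ab|ab] := eqVneq (level a) (level b).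
  by move: (xG_eq0 a b); rewrite ab eqxx => /eqP->; rewrite mul0r.
have [bc|bc] := eqVneq (level b) (level c).
  by move: (xG_eq0 b c); rewrite bc eqxx => /eqP->; rewrite mulr0.
move=> nabc; rewrite xG_mul //.
have -> : (level b < level a)%N = (level b < level c)%N.
  move: nabc ab bc; rewrite /monotone.
  by clear; move: (level a) (level b) (level c) => i j k; lia.
by rewrite subrr expr0z subrr scale0r.
Qed.

Lemma xG_mul_monotone (a b c : 'Z_N) : monotone (@level N) a b c ->
  exists2 k : C, k != 0 & xG a b * xG b c = k *: xG a c.
Proof.
move=> mabc; pose p := (level b < level a)%N.
have [ab bc ac] : [/\ level a != level b, level b != level c & level a != level c].
  move: mabc; rewrite /monotone.
  by clear; move: (level a) (level b) (level c) => i j k h; split; lia.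
have [bcE abE cbE] : [/\ (level b < level c)%N = ~~ p,
    (level a < level b)%N = (level a < level c)%N &
    (level c < level b)%N = (level c < level a)%N].
  move: mabc; rewrite /p /monotone.
  by clear; move: (level a) (level b) (level c) => i j k h; split; lia.
(* The comparisons at [b] are opposite, so the shifts differ by plus or minus [2 * n], and [uN]
   makes the scalar nonzero. *)
exists (1 - u ^ (shift n b p - shift n b (~~ p))).
  rewrite subr_eq0 eq_sym; have uN1 : u ^ (N%:Z) != 1 by [].
  have uN2 : u ^ (- N%:Z) != 1 by rewrite -invr_expz invr_eq1.
  rewrite N2n in uN1 uN2.
  have : shift n b p - shift n b (~~ p) \in [:: (2 * n)%:Z; - (2 * n)%:Z].
    rewrite !inE /shift; move: (p) => q; clear.
    by case: q; case: ifP => _ /=; lia.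
  by rewrite !inE => /orP[] /eqP->.
by rewrite xG_mul // bcE -/p /xG (negPf ac) abE cbE.
Qed.

Lemma level_exists k : (k <= n)%N -> exists c : 'Z_N, level c = k.
Proof.
move=> kn; have kN : (k < N)%N by move: kn N2n; clear; lia.
exists (inZp k); rewrite levelE /= modn_small //; move: kn; clear.
by rewrite /minn; case: ifP; lia.
Qed.

Lemma level_le (a : 'Z_N) : (level a <= n)%N.
Proof. by have := ltn_Z2n a; rewrite levelE; clear; lia. Qed.

Lemma level_between (a b : 'Z_N) k :
  (level a < k < level b)%N -> exists c : 'Z_N, level c = k.
Proof.
by case/andP=> _ /ltnW kb; apply: level_exists; apply: leq_trans (level_le b).
Qed.

Lemma T_in_idem_span : T_op R N \in (\sum_(a : 'Z_N) <[idemG R a]>)%VS.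
Proof.
by rewrite T_opE; apply: memv_sumr => a _; rewrite memvZ ?memv_line.
Qed.

Lemma Lambda_xG : Lambda_op N u = \sum_(a : 'Z_N) \sum_(b : 'Z_N) coef u (a - b) *: xG a b.
Proof.
rewrite (Lambda_opE N2n) //; apply: eq_bigr => a _; apply: eq_bigr => b _.
exact: Gop_coefE.
Qed.

Lemma Lambda_in_xG_span :
  Lambda_op N u \in (\sum_(p : 'Z_N * 'Z_N) <[xG p.1 p.2]>)%VS.
Proof.
rewrite Lambda_xG pair_big; apply: memv_sumr => p _.
by rewrite memvZ ?memv_line.
Qed.

Lemma idem_Lambda_idem (a b : 'Z_N) : ldist (@level N) a b = 1%N ->
  exists2 k : C, k != 0 & idemG R a * Lambda_op N u * idemG R b = k *: xG a b.
Proof.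
move=> ab1; exists (coef u (a - b)).
  apply: coef_neq0; rewrite odd_addZ odd_oppZ -!odd_level.
  by move: ab1; rewrite /ldist; clear; move: (level a) (level b); lia.
rewrite Lambda_xG; apply: (peirce_component (@idemG_M R M)) => a' b'.
by rewrite -scalerAr -scalerAl idem_xG_idem.
Qed.

End PathBasis.

(** * Counting pairs of residues by level distance *)

Section LevelCount.

Variables (M n : nat).
Local Notation N := M.+2.
Hypothesis N2n : N = (2 * n)%N.

(** The residues 0, ..., n-1 have levels 0, ..., n-1, and the residues n, ..., 2n-1 have levels n,
    ..., 1. *)
Lemma sum_level (F : nat -> nat) :
  (\sum_(a : 'Z_N) F (level a) = \sum_(i < n) (F i + F i.+1))%N.
Proof.
have -> : (\sum_(a : 'Z_N) F (level a) = \sum_(0 <= a < n + n) F (minn a (n + n - a)))%N.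
  by rewrite big_mkord addnn -mul2n -N2n.
rewrite (big_cat_nat _ (n := n)) ?leq_addr //= big_split /=; congr (_ + _)%N.
  rewrite big_mkord; apply: eq_bigr => i _; congr F.
  by have := ltn_ord i; lia.
rewrite -{1}[n]add0n big_addn addnK big_nat_rev add0n big_mkord.
by apply: eq_bigr => i _; congr F; have := ltn_ord i; lia.
Qed.

Lemma sum_ord_geq m c : (\sum_(i < m) (c <= i) = m - c)%N.
Proof.
elim: m => [|m IHm]; first by rewrite big_ord0.
by rewrite big_ord_recr /= IHm; case: leqP => h; lia.
Qed.

Lemma sum_ord_subn m c : (c <= m)%N -> ((\sum_(i < m) (c - i)) * 2 = c * c.+1)%N.
Proof.
elim: m c => [|m IHm] c; first by rewrite leqn0 big_ord0 => /eqP->.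
case: c => [|c] cm; first by rewrite big1 // => i _; rewrite sub0n.
rewrite big_ord_recl subn0 mulnDl.
under eq_bigr => i _ do rewrite lift0 subSS.
by rewrite IHm //; lia.
Qed.

Lemma card_ldist_geq r : (0 < r <= n)%N ->
  #|[pred p : 'Z_N * 'Z_N | (r <= ldist (@level N) p.1 p.2)%N]| =
    (2 + 4 * (n - r) * (n - r + 1))%N.
Proof.
case/andP=> r0 rn.
(* [G i] counts the residues of level at least [i + r]. By symmetry the count is twice that of the
   pairs whose second level is the larger one; [r > 0] makes the two cases disjoint. *)
pose G i := (\sum_(b : 'Z_N) (i + r <= level b))%N.
have -> : #|[pred p : 'Z_N * 'Z_N | (r <= ldist (@level N) p.1 p.2)%N]| =
    (2 * \sum_(a : 'Z_N) G (level a))%N.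
  have GC : (\sum_(a : 'Z_N) G (level a) =
      \sum_(a : 'Z_N) \sum_(b : 'Z_N) (level b + r <= level a))%N.
    exact: exchange_big.
  rewrite mul2n -addnn {2}GC -big_split /= -sum1_card big_mkcond /=.
  rewrite -(pair_big xpredT xpredT
    (fun a b => if (r <= ldist (@level N) a b)%N then 1%N else 0%N)) /=.
  apply: eq_bigr => a _; rewrite /G -big_split /=; apply: eq_bigr => b _.
  rewrite /ldist; move: (level a) (level b) r0; clear => i j r0.
  have -> : (r <= i - j + (j - i))%N = (i + r <= j)%N || (j + r <= i)%N by lia.
  have : ~~ ((i + r <= j)%N && (j + r <= i)%N) by lia.
  by case: (i + r <= j)%N; case: (j + r <= i)%N.
have GE i : G i = ((n - (i + r)) + (n - (i + r).-1))%N.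
  rewrite /G (sum_level (fun k => (i + r <= k) : nat)) big_split /= sum_ord_geq.
  congr (_ + _)%N; rewrite -sum_ord_geq; apply: eq_bigr => j _.
  by congr nat_of_bool; lia.
rewrite sum_level; under eq_bigr => i _ do rewrite !GE.
(* Regrouping yields triangular sums with largest terms n-r, n-r+1, n-r-1 and again n-r. *)
have -> : (\sum_(i < n) (n - (i + r) + (n - (i + r).-1) +
                      (n - (i.+1 + r) + (n - (i.+1 + r).-1))) =
  \sum_(i < n) (n - r - i) + \sum_(i < n) ((n - r).+1 - i) +
    (\sum_(i < n) ((n - r).-1 - i) + \sum_(i < n) (n - r - i)))%N.
  rewrite -!big_split /=; apply: eq_bigr => i _.
  by move: (i : nat) rn r0; clear=> k *; lia.
have S1 := @sum_ord_subn n (n - r) (leq_subr _ _).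
have S2 : ((\sum_(i < n) ((n - r).+1 - i)) * 2 = (n - r).+1 * (n - r).+2)%N.
  by apply: sum_ord_subn; lia.
have S3 : ((\sum_(i < n) ((n - r).-1 - i)) * 2 = (n - r).-1 * (n - r).-1.+1)%N.
  by apply: sum_ord_subn; lia.
move: S1 S2 S3; move: (\sum_(i < n) _)%N (\sum_(i < n) _)%N (\sum_(i < n) _)%N.
by case: (n - r)%N => [|m] x y z /=; nia.
Qed.

End LevelCount.

Lemma dim_quot_sub (K : fieldType) (aT : falgType K) (U V : {vspace aT}) :
  (V <= U)%VS -> dim_quot U V = (\dim U - \dim V)%N.
Proof.
by move=> VU; rewrite /dim_quot -(dimv_cap_compl U V) (capv_idPr VU) addKn.
Qed.

(** * The algebra A: radical, dimensions and projective modules *)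

Section MainAlgebra.

Variables (R : realType) (M n : nat) (u : R[i]).
Local Notation N := M.+2.
Hypotheses (N2n : N = (2 * n)%N) (u0 : u != 0) (uN : u ^+ N != 1).

Local Notation A := (algA N u).
Local Notation J := (idealJ N u).
Local Notation lev := (@level N).
Local Notation e := (@idemG R M).
Local Notation X := (xspan lev (xG n u)).

Ltac level_hyps := first
  [ exact: idemG_sum | exact: idemG_M | exact: idemG_neq0
  | exact: idem_xG_idem | exact: xG_eq0 | exact: xG_mul_monotone
  | exact: xG_mul_eq0 | exact: (level_between N2n) | exact: T_in_idem_span
  | exact: idemG_in_alg | exact: Lambda_in_xG_span | exact: idem_Lambda_idem ].

Lemma idealJ_expE r : (0 < r)%N -> (J ^+ r)%VS = X r.
Proof. by move=> r0; apply: (@level_ideal_expE _ _ _ _ e) => //; level_hyps. Qed.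

Lemma idealJE : J = X 1.
Proof. exact: (@idealJ_expE 1). Qed.

Lemma algAE : A = (espan e + X 1)%VS :> {vspace End2N R N}.
Proof. by apply: level_algE; level_hyps. Qed.

Lemma algA_xspan r : (A * X r <= X r)%VS.
Proof. by apply: (@alg_xspan _ _ _ _ e); level_hyps. Qed.

Lemma xspan_algA r : (X r * A <= X r)%VS.
Proof. by apply: (@xspan_alg _ _ _ _ e); level_hyps. Qed.

Lemma idem_notin_idealJ a : e a \notin J.
Proof. by apply: (@e_notin_ideal _ _ _ lev _ (xG n u)); level_hyps. Qed.

Lemma idealJ_nil : (J ^+ n.+1)%VS = 0%VS.
Proof.
apply: (@level_ideal_nil _ _ _ lev e (xG n u)) => [||||||||||||a] //; try level_hyps.
exact: level_le.
Qed.

Lemma blockE a b : lev a != lev b -> block u a b = <[xG n u a b]>%VS.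
Proof.
move=> ab; rewrite /block !idemE.
by apply: (@corner_alg _ _ _ lev e) ab; level_hyps.
Qed.

Lemma dim_idealJ_exp r : (0 < r <= n)%N ->
  \dim (J ^+ r)%VS = (2 + 4 * (n - r) * (n - r + 1))%N.
Proof.
move=> r1n; have /andP[r0 _] := r1n.
rewrite idealJ_expE // (@dim_xspan _ _ _ _ e) //; try level_hyps.
exact: card_ldist_geq.
Qed.

Lemma dim_algA : \dim A = (N ^ 2 - N + 2)%N.
Proof.
have n0 : (0 < n)%N by move: N2n; clear; lia.
rewrite (@dim_level_alg _ _ _ lev e (xG n u)) //; try level_hyps.
rewrite card_ord -idealJ_expE // dim_idealJ_exp //.
rewrite [(Zp_trunc N).+2]/=; move: n0; rewrite N2n; case: (n) => // m _.
by rewrite subn1 /=; clear; nia.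
Qed.

Lemma sub_idealJ_algA : (J <= A)%VS.
Proof. by rewrite idealJE algAE addvSr. Qed.

Lemma mul_algA_idealJ : (A * J <= J)%VS.
Proof. by rewrite idealJE algA_xspan. Qed.

Lemma mul_idealJ_algA : (J * A <= J)%VS.
Proof. by rewrite idealJE xspan_algA. Qed.

Lemma algA_sub_idem_idealJ : (A <= \sum_a <[e a]> + J)%VS.
Proof. by rewrite idealJE algAE. Qed.

Lemma idealJ_is_jacobson_radical : is_jacobson_radical A J.
Proof.
exact: (nilpotent_is_jacobson_radical sub_idealJ_algA mul_algA_idealJ
  mul_idealJ_algA idealJ_nil (idemG_in_alg u) (idemG_sum R M) (@idemG_M R M)
  idem_notin_idealJ algA_sub_idem_idealJ).
Qed.

Lemma eJE a r : (0 < r)%N -> eJ u a r = (<[e a]> * X r)%VS.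
Proof. by move=> r0; rewrite /eJ idemE idealJ_expE. Qed.

Lemma dim_eJ_idem a b r : (0 < r)%N ->
  \dim (eJ u a r * <[e b]>) = (r <= ldist lev a b)%N.
Proof.
move=> r0; rewrite eJE // corner_xspan; try level_hyps.
case: leqP => [rab|_]; last by rewrite dimv0.
by rewrite dim_vline xG_eq0 -ldist_eq0 -lt0n (leq_trans r0).
Qed.

Lemma eJ_submod a r : (0 < r)%N -> (eJ u a r * A <= eJ u a r)%VS.
Proof. by move=> r0; rewrite eJE // -prodvA prodvSr ?xspan_algA. Qed.

Lemma eJ_composition_series a r : (0 < r)%N ->
  exists s, composition_series A (eJ u a r) (eJ u a r.+1) s.
Proof.
move=> r0; apply: (composition_series_exists mul_algA_idealJ (idemG_in_alg u)
  (idemG_sum R M) (@idemG_M R M) algA_sub_idem_idealJ).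
- exact: eJ_submod.
- exact: eJ_submod.
- by rewrite !eJE // prodvSr // xspan_anti.
- by rewrite /eJ -prodvA expvSr.
Qed.

(** The multiplicity is the dimension of e_a J^r e_b minus that of e_a J^(r+1) e_b, each being 1 or
    0 according to the distance. *)
Lemma eJ_multiplicity a r s b : (0 < r)%N ->
    composition_series A (eJ u a r) (eJ u a r.+1) s ->
  top_multiplicity A (eJ u a r.+1) s (projP u b) = (ldist lev a b == r).
Proof.
move=> r0 /(composition_multiplicity sub_idealJ_algA mul_algA_idealJ
  mul_idealJ_algA idealJ_nil (idemG_in_alg u) (idemG_sum R M) (@idemG_M R M)
  idem_notin_idealJ algA_sub_idem_idealJ (eJ_submod a r0))/(_ b).
rewrite !dim_eJ_idem // /projP idemE.
by case: ltngtP => // _; case: top_multiplicity => [|[]].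
Qed.

Lemma eJ_factor_top a r s i : (0 < r)%N ->
    composition_series A (eJ u a r) (eJ u a r.+1) s -> (i < size s)%N ->
  exists b, ldist lev a b = r /\
    quot_iso_top A (nth (eJ u a r.+1) s i)
      (nth (eJ u a r.+1) (eJ u a r.+1 :: s) i) (projP u b).
Proof.
move=> r0 ser lti.
have [b] := composition_factor_top sub_idealJ_algA mul_algA_idealJ
  mul_idealJ_algA idealJ_nil (idemG_in_alg u) (idemG_sum R M) (@idemG_M R M)
  idem_notin_idealJ algA_sub_idem_idealJ (eJ_submod a r0) ser lti.
rewrite -idemE -/(projP u b) (eJ_multiplicity _ r0 ser).
by case: eqP => // abr _ top; exists b.
Qed.

(** This lets an arbitrary choice of block generators replace [xG]. *)
Lemma spans_blocks_line x : spans_blocks u x ->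
  forall a b, lev a != lev b -> <[x a b]>%VS = <[xG n u a b]>%VS.
Proof. by move=> xB a b ab; have [_ <-] := xB a b ab; apply: blockE. Qed.

Lemma spans_blocks_peirce x : spans_blocks u x ->
  forall a b, lev a != lev b -> e a * x a b * e b = x a b.
Proof.
move=> xB a b ab; have /vlineP[k ->] : x a b \in <[xG n u a b]>%VS.
  by rewrite -(spans_blocks_line xB ab) memv_line.
by rewrite -scalerAr -scalerAl idem_xG_idem.
Qed.

Lemma level_distE (a b : 'Z_N) : level_dist a b = ldist lev a b.
Proof. by rewrite /level_dist /ldist; clear; lia. Qed.

End MainAlgebra.

Theorem corollary6p2 (R : realType) (n N : nat) (u : R[i])
    (hN : N = (2 * n)%N) (hN4 : (4 <= N)%N) (hu0 : u != 0) (huN : u ^+ N != 1) :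
  let A := algA N u in
  let J := idealJ N u in
  (* J^r is the direct sum of the lines C x_{a,b} *)
  (forall x : 'Z_N -> 'Z_N -> End2N R N, spans_blocks u x ->
     forall r : nat, (1 <= r <= n)%N ->
       (J ^+ r)%VS =
         (\sum_(p : 'Z_N * 'Z_N | (r <= level_dist p.1 p.2)%N) <[x p.1 p.2]>)%VS
       /\ directv
         (\sum_(p : 'Z_N * 'Z_N | (r <= level_dist p.1 p.2)%N) <[x p.1 p.2]>)%VS)
  (* dimensions *)
  /\ \dim A = (N ^ 2 - N + 2)%N
  /\ (forall r : nat, (1 <= r <= n)%N ->
        \dim (J ^+ r)%VS = (2 + 4 * (n - r) * (n - r + 1))%N)
  /\ dim_quot A J = N
  /\ (forall r : nat, (1 <= r < n)%N ->
        dim_quot (J ^+ r)%VS (J ^+ r.+1)%VS = (8 * (n - r))%N)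
  /\ \dim (J ^+ n)%VS = 2%N
  (* the radical and the Loewy length *)
  /\ is_jacobson_radical A J
  /\ (J ^+ n)%VS <> 0%VS
  /\ (J ^+ n.+1)%VS = 0%VS
  /\ is_loewy_length J n.+1
  (* composition factors of the radical layers e_a J^r / e_a J^(r+1) *)
  /\ (forall (a : 'Z_N) (r : nat), (1 <= r <= n)%N ->
        let W := eJ u a r.+1 in
        (exists s, composition_series A (eJ u a r) W s) /\
        (forall s, composition_series A (eJ u a r) W s ->
           (forall b : 'Z_N, level_dist a b = r ->
              top_multiplicity A W s (projP u b) = 1%N) /\
           (forall b : 'Z_N, level_dist a b <> r ->
              top_multiplicity A W s (projP u b) = 0%N) /\
           (forall i : nat, (i < size s)%N ->
              exists b : 'Z_N, level_dist a b = r /\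
                quot_iso_top A (nth W s i) (nth W (W :: s) i) (projP u b)))).
Proof.
(* With [N] written as [M.+2], the index type ['Z_N] has [N] elements by computation. *)
case: N hN hN4 huN => [|[|M]] // hN hN4 huN A J.
have n0 : (0 < n)%N by move: hN; clear; lia.
have dimJ r := @dim_idealJ_exp R M n u hN hu0 huN r.
have sJrJ r : (0 < r)%N -> (J ^+ r.+1 <= J ^+ r)%VS.
  by move=> r0; rewrite /J !(idealJ_expE hN hu0 huN) // xspan_anti.
have dimJn : \dim (J ^+ n)%VS = 2%N by rewrite dimJ ?n0 ?leqnn // subnn.
have Jn0 : (J ^+ n)%VS <> 0%VS by move=> Jn; move: dimJn; rewrite Jn dimv0.
have Jnil : (J ^+ n.+1)%VS = 0%VS by apply: idealJ_nil.
split=> [x xB r /andP[r0 rn]|].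
  (* As [r >= 1], the sum runs only over pairs of distinct levels, those governed by
     [spans_blocks]. *)
  have lev_neq (p : 'Z_M.+2 * 'Z_M.+2) : (r <= level_dist p.1 p.2)%N -> level p.1 != level p.2.
    by rewrite level_distE -ldist_eq0 -lt0n; apply: leq_trans.
  split.
    rewrite /J (idealJ_expE hN hu0 huN) //; symmetry.
    apply: eq_big => [p|p /lev_neq p12]; first by rewrite level_distE.
    exact: (spans_blocks_line hN hu0 huN xB).
  apply: (peirce_directv (@idemG_M R M)) => p /lev_neq.
  exact: (spans_blocks_peirce hN hu0 huN xB).
split; first exact: (dim_algA hN).
split=> [r|]; first exact: dimJ.
split.
  rewrite dim_quot_sub ?(sub_idealJ_algA hN) // (dim_algA hN) //.
  rewrite -[X in (_ - \dim X)%N]expv1 dimJ ?n0 // hN; move: n0; clear.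
  by case: n => // m _; rewrite subn1 /=; nia.
split=> [r /andP[r0 rn]|].
  rewrite dim_quot_sub ?sJrJ // !dimJ ?r0 1?ltnW //; move: rn; clear=> rn.
  have -> : (n - r = (n - r.+1).+1)%N by lia.
  by move: (n - r.+1)%N => m; nia.
do 2!split=> //; first exact: (idealJ_is_jacobson_radical hN).
do 2!split=> //.
split.
  (* If [J ^+ r] vanished for some [r <= n], then so would [J ^+ n], which has [J ^+ r] as a
     factor. *)
  split=> // r Jr; rewrite ltnNge; apply/negP => rn; case: Jn0.
  by rewrite -(subnKC rn) expvD Jr prod0v.
move=> a r /andP[r0 rn] W; split; first exact: (eJ_composition_series hN).
move=> s ser; split=> [b|].
  by rewrite level_distE (eJ_multiplicity hN hu0 huN _ r0 ser) => ->; rewrite eqxx.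
split=> [b|i lti].
  by rewrite level_distE (eJ_multiplicity hN hu0 huN _ r0 ser) => /eqP/negPf->.
have [b [abr top]] := eJ_factor_top hN hu0 huN r0 ser lti.
by exists b; rewrite level_distE.
Qed.
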